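(* Let $K,N\in\mathbb{N}$, $\mathbf{g}=(g_1,\ldots,g_K)\in(0,\infty)^K$, $\mathbf{r}=(r_1,\ldots,r_N)\in(0,1)^N$, $\mathbf{m}=(m_1,\ldots,m_N)\in\mathbb{C}^N$, and let $\eta$ be the generalized self-similar string with gaps $\mathbf{g}$, initial scaling ratios $\mathbf{r}$ and initial multiplicities $\mathbf{m}$. Then the geometric zeta function $\zeta_\eta$ of $\eta$ has a meromorphic continuation to $\mathbb{C}$ given by $$\zeta_\eta(s)=\frac{\sum_{k=1}^K g_k^s}{1-\sum_{j=1}^N m_j r_j^s},\qquad s\in\mathbb{C}.$$
   Context: $\mathbb{N}=\{1,2,3,\ldots\}$. Let $\mathscr{J}=\bigcup_{q\ge 0}\{1,\ldots,N\}^q$ be the set of all finite words in the letters $1,\ldots,N$, including the empty word. For $J=j_1\cdots j_q\in\mathscr{J}$ put $r_J=\prod_{i=1}^q r_{j_i}$ and $m_J=\prod_{i=1}^q m_{j_i}$, with $r_J=m_J=1$ for the empty word. The generalized self-similar string with gaps $\mathbf{g}$, initial scaling ratios $\mathbf{r}$ and initial multiplicities $\mathbf{m}$ is the local complex measure on $(0,\infty)$ $$\eta=\sum_{k=1}^K\sum_{J\in\mathscr{J}} m_J\,\delta_{\{g_k^{-1}r_J^{-1}\}},$$ where $\delta_{\{x\}}$ is the Dirac mass at $x$. (A local complex measure on $(0,\infty)$ is a complex-valued set function whose restriction to every bounded subinterval is a complex measure.) With $|\eta|$ the total variation measure, the dimension of $\eta$ is $D_\eta=\inf\{\sigma\in\mathbb{R}:\int_0^\infty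 x^{-\sigma}|\eta|(dx)<\infty\}$, and the geometric zeta function of $\eta$ is $\zeta_\eta(s)=\int_0^\infty x^{-s}\,\eta(dx)$ for $\mathrm{Re}(s)>D_\eta$. *)

(* Defs.v *)
From HB Require Import structures.
From mathcomp Require Export all_boot all_order all_algebra complex.
From mathcomp Require Export all_classical all_reals all_analysis.

#[export] Set Implicit Arguments.
#[export] Unset Strict Implicit.
#[export] Unset Printing Implicit Defensive.

Export Order.TTheory GRing.Theory Num.Theory.
Export numFieldNormedType.Exports.

Open Scope classical_set_scope.
Open Scope complex_scope.
Open Scope ring_scope.

Section local_complex_measures.
Context (R : realType).
Implicit Types (A B E : set R) (F : nat -> set R).

Definition complex_measure_on E (nu : set R -> R[i]) : Prop :=
  nu set0 = 0 /\
  forall F, (forall n, measurable (F n)) -> (forall n, F n `<=` E) ->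
    trivIset setT F ->
    (\sum_(k < n) nu (F k) : R[i]^o) @[n --> \oo] -->
      (nu (\bigcup_n F n) : R[i]^o).

(* Only the values on Borel subsets of bounded subintervals of (0, +oo) are
   meaningful. *)
Record localComplexMeasure := LocalComplexMeasure {
  lcm_fun :> set R -> R[i];
  lcmP : forall i : interval R, [set` i] `<=` `]0, +oo[ ->
    bounded_set [set` i] -> complex_measure_on [set` i] lcm_fun }.

Definition bounded_borel A : Prop :=
  [/\ measurable A, A `<=` `]0, +oo[ & bounded_set A].

(* The supremum over sequences of disjoint pieces of A is the supremum over
   partitions of A (when A is a Borel subset of (0, +oo)), and it also covers
   unbounded A, as the pieces are bounded. *)
Definition total_variation (nu : set R -> R[i]) A : \bar R :=
  ereal_sup [set (\sum_(0 <= n <oo) (ComplexField.Normc.normc (nu (F n)))%:E)%E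
    | F in [set F | [/\ forall n, bounded_borel (F n),
                        forall n, F n `<=` A & trivIset setT F]]].

(* The positive part of the Jordan decomposition of a real local measure. *)
Definition upper_variation (rho : set R -> R) A : \bar R :=
  ereal_sup [set (rho B)%:E | B in [set B | bounded_borel B /\ B `<=` A]].

Definition re_pos (nu : set R -> R[i]) := upper_variation (fun B => complex.Re (nu B)).
Definition re_neg (nu : set R -> R[i]) := upper_variation (fun B => - complex.Re (nu B)).
Definition im_pos (nu : set R -> R[i]) := upper_variation (fun B => complex.Im (nu B)).
Definition im_neg (nu : set R -> R[i]) := upper_variation (fun B => - complex.Im (nu B)).

End local_complex_measures.

Section measure_proofs.
Context (R : realType).
Implicit Types (A B E : set R) (F : nat -> set R).

Lemma bounded_borelP A : bounded_borel A ->
  exists b : R, A `<=` [set` `]0, b] ].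
Proof.
case=> mA A0 [M [Mr bA]]; exists (M + 1) => x Ax /=.
have := A0 _ Ax; rewrite /= !in_itv/= andbT => -> /=.
by apply: (le_trans (ler_norm x)); apply: bA => //; rewrite ltrDl.
Qed.

Lemma subset_bounded_borel A B : measurable A -> A `<=` B ->
  bounded_borel B -> bounded_borel A.
Proof.
move=> mA AB [mB B0 bB]; split=> //; first exact: subset_trans AB B0.
by move: bB => [M [Mr bB]]; exists M; split=> // N MN x /AB; exact: (bB N MN x).
Qed.

Lemma bounded_borel0 : bounded_borel (set0 : set R).
Proof. by split => //; exists 0; split => // M M0 x. Qed.

Lemma bounded_setU_R (A B : set R) : bounded_set A -> bounded_set B -> bounded_set (A `|` B).
Proof.
move=> [M [Mr bA]] [M' [Mr' bB]]; exists (Num.max M M'); split.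
  by rewrite num_real.
by move=> x; rewrite gt_max => /andP[h1 h2] y [/(bA _ h1)|/(bB _ h2)].
Qed.

Lemma bounded_borelU A B : bounded_borel A -> bounded_borel B ->
  bounded_borel (A `|` B).
Proof.
move=> [mA A0 bA] [mB B0 bB]; split; first exact: measurableU.
- by rewrite subUset.
- exact: bounded_setU_R.
Qed.

Lemma itv_bounded (b : R) : bounded_set [set` `]0, b] ].
Proof.
exists b; split; first by rewrite num_real.
move=> M bM x; rewrite /= in_itv/= => /andP[x0 xb].
by rewrite gtr0_norm// (le_trans xb)// ltW.
Qed.

Lemma lcm_cvg (nu : localComplexMeasure R) F : (forall n, measurable (F n)) ->
  bounded_borel (\bigcup_n F n) -> trivIset setT F ->
  (\sum_(k < n) nu (F k) : R[i]^o) @[n --> \oo] -->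
      (nu (\bigcup_n F n) : R[i]^o).
Proof.
move=> mF /bounded_borelP[b Fb] tF.
have i0 : [set` `]0, b] ] `<=` [set` `]0%R, +oo[ : interval R].
  by move=> x /=; rewrite !in_itv/= => /andP[-> _].
case: (lcmP nu i0 (@itv_bounded b)) => _; apply => // n.
by apply: subset_trans Fb; exact: bigcup_sup.
Qed.

Lemma lcm0 (nu : localComplexMeasure R) : nu set0 = 0.
Proof.
have i0 : [set` `]0, 0] ] `<=` [set` `]0%R, +oo[ : interval R].
  by move=> x /=; rewrite !in_itv/= => /andP[-> _].
by case: (lcmP nu i0 (@itv_bounded 0)).
Qed.

Definition loc_sigma_additive (rho : set R -> R) := rho set0 = 0 /\
  forall F, (forall n, measurable (F n)) ->
  bounded_borel (\bigcup_n F n) -> trivIset setT F ->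
  (\sum_(k < n) rho (F k)) @[n --> \oo] --> rho (\bigcup_n F n).

Lemma loc_sigma_additiveN rho : loc_sigma_additive rho ->
  loc_sigma_additive (fun A => - rho A).
Proof.
move=> [r0 rc]; split; first by rewrite r0 oppr0.
move=> F mF bF tF; under eq_fun do rewrite sumrN.
by apply: cvgN; exact: rc.
Qed.

Lemma normc_Re (z : R[i]) : `|complex.Re z| <= ComplexField.Normc.normc z.
Proof. by rewrite -lecR; exact: normc_ge_Re. Qed.

Lemma normc_Im (z : R[i]) : `|complex.Im z| <= ComplexField.Normc.normc z.
Proof.
case: z => a b /=; rewrite -sqrtr_sqr ler_wsqrtr// lerDr; exact: sqr_ge0.
Qed.

Lemma cvg_normc (u : nat -> R[i]) (l : R[i]) :
  (u n : R[i]^o) @[n --> \oo] --> (l : R[i]^o) <->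
  forall e : R, 0 < e -> \forall n \near \oo, ComplexField.Normc.normc (l - u n) < e.
Proof.
split => [/(@cvgrPdist_lt R[i]) H e e0|H].
  have e0' : 0 < e%:C by rewrite ltcR.
  by near=> n; rewrite -ltcR; near: n; apply: H.
apply/(@cvgrPdist_lt R[i]) => e e0.
have er : e = (complex.Re e)%:C.
  by move: e0; case: e => a b; rewrite ltcE/= => /andP[/eqP -> _].
have e0' : 0 < complex.Re e by rewrite -ltcR -er.
by near=> n; rewrite er ltcR; near: n; apply: H.
Unshelve. all: by end_near. Qed.

Lemma lcm_Re (nu : localComplexMeasure R) :
  loc_sigma_additive (fun A => complex.Re (nu A)).
Proof.
split => [|F mF bF tF]; first by rewrite lcm0.
apply/cvgrPdist_lt => e e0.
have /cvg_normc/(_ _ e0) := @lcm_cvg nu F mF bF tF.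
apply: filterS => n; apply: le_lt_trans.
apply: le_trans (normc_Re _).
by rewrite raddfB/= (raddf_sum (@complex.Re R)) lexx.
Qed.

Lemma lcm_Im (nu : localComplexMeasure R) :
  loc_sigma_additive (fun A => complex.Im (nu A)).
Proof.
split => [|F mF bF tF]; first by rewrite lcm0.
apply/cvgrPdist_lt => e e0.
have /cvg_normc/(_ _ e0) := @lcm_cvg nu F mF bF tF.
apply: filterS => n; apply: le_lt_trans.
apply: le_trans (normc_Im _).
by rewrite raddfB/= (raddf_sum (@complex.Im R)) lexx.
Qed.

Lemma loc_additiveU rho A B : loc_sigma_additive rho ->
  bounded_borel A -> bounded_borel B -> A `&` B = set0 ->
  rho (A `|` B) = rho A + rho B.
Proof.
move=> [r0 rc] bA bB AB.
have mF n : measurable (bigcup2 A B n).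
  by case: n => [|[|n]]; [case: bA|case: bB|exact: measurable0].
have := rc _ mF; rewrite bigcup2E => /(_ (bounded_borelU bA bB)).
have tF : trivIset setT (bigcup2 A B) by rewrite -trivIset_bigcup2.
move=> /(_ tF) h.
apply: (cvg_unique _ h) => //.
apply: cvg_near_cst; exists 2%N => // -[|[|n]]// _.
rewrite 2!big_ord_recl/= big1 ?addr0// => i _; exact: r0.
Qed.

(* A nonnegative monotone set function, superadditive on pairs and countably
   subadditive on disjoint sequences, is a measure. *)
Lemma semi_sigma_additive_of (mu : set R -> \bar R) :
  mu set0 = 0%E -> (forall A, (0 <= mu A)%E) ->
  (forall A B, A `<=` B -> (mu A <= mu B)%E) ->
  (forall A B, measurable A -> measurable B -> A `&` B = set0 ->
     (mu A + mu B <= mu (A `|` B))%E) ->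
  (forall F, (forall n, measurable (F n)) -> trivIset setT F ->
     (mu (\bigcup_n F n) <= \sum_(0 <= n <oo) mu (F n))%E) ->
  semi_sigma_additive mu.
Proof.
move=> mu0 muge0 mule musup musub F mF tF mUF.
have -> : mu (\bigcup_n F n) = (\sum_(0 <= n <oo) mu (F n))%E; last first.
  by apply: is_cvg_nneseries => *; exact: muge0.
apply/eqP; rewrite eq_le musub//=.
apply: lime_le; first by apply: is_cvg_nneseries => *; exact: muge0.
apply: nearW => n.
apply: (@le_trans _ _ (mu (\big[setU/set0]_(0 <= k < n) F k))); last first.
  by apply: mule; rewrite big_mkord; exact: bigsetU_bigcup.
elim: n => [|n IH]; first by rewrite !big_geq// mu0.
rewrite !big_nat_recr//=; apply: le_trans (musup _ _ _ _ _) => //.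
- by rewrite leeD2r.
- by apply: bigsetU_measurable.
- rewrite big_mkord (@trivIset_bigsetUI _ xpredT)//.
  by rewrite [X in trivIset X F](_ : _ = [set: nat])//; exact/seteqP.
Qed.

Lemma ereal_sup_superadd (S T : set (\bar R)) (c : \bar R) :
  (forall a, S a -> (-oo < a)%E) -> (forall b, T b -> (-oo < b)%E) ->
  S !=set0 -> T !=set0 -> (forall a b, S a -> T b -> (a + b <= c)%E) ->
  (ereal_sup S + ereal_sup T <= c)%E.
Proof.
move=> S0 T0 [a0 Sa0] [b0 Tb0] ST.
have [->|cy] := eqVneq c +oo%E; first exact: leey.
have fin a b : S a -> T b -> (a \is a fin_num) /\ (b \is a fin_num).
  move=> Sa Tb; move: (ST _ _ Sa Tb) (S0 _ Sa) (T0 _ Tb).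
  case: a {Sa} => [a| |]; case: b {Tb} => [b| |]; rewrite ?ltxx//.
  - by rewrite addey// leye_eq (negbTE cy).
  - by rewrite addye// leye_eq (negbTE cy).
  - by rewrite addye// leye_eq (negbTE cy).
have cfin : c \is a fin_num.
  have [+ +] := fin _ _ Sa0 Tb0; move: (ST _ _ Sa0 Tb0) cy.
  by case: c {ST} => //; case: a0 {Sa0} => //; case: b0 {Tb0}.
have TleS a : S a -> (ereal_sup T <= c - a)%E.
  move=> Sa; apply: ge_ereal_sup => b Tb.
  by have [fa fb] := fin _ _ Sa Tb; rewrite leeBrDl//; exact: ST.
have fT : ereal_sup T \is a fin_num.
  have [fa fb] := fin _ _ Sa0 Tb0; rewrite fin_numElt; apply/andP; split.
    by apply: (lt_le_trans (T0 _ Tb0)); exact: ereal_sup_ubound.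
  apply: (le_lt_trans (TleS _ Sa0)); rewrite ltey_eq.
  by rewrite fin_numB cfin fa.
rewrite -leeBrDr//; apply: ge_ereal_sup => a Sa.
have [fa _] := fin _ _ Sa Tb0.
by rewrite leeBrDr// addeC -leeBrDr//; exact: TleS.
Qed.

Section upper_variation.
Context (rho : set R -> R) (rhoP : loc_sigma_additive rho).
Local Notation mu := (upper_variation rho).

Lemma upper_variation_ge0 A : (0 <= mu A)%E.
Proof.
apply: ereal_sup_ubound; exists set0; last by case: rhoP => ->.
by split => //; exact: bounded_borel0.
Qed.

Lemma upper_variation0 : mu set0 = 0%E.
Proof.
apply/eqP; rewrite eq_le upper_variation_ge0 andbT.
apply: ge_ereal_sup => _ [B [_ B0] <-].
move: B0; rewrite subset0 => ->; by case: rhoP => ->.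
Qed.

Lemma le_upper_variation A B : A `<=` B -> (mu A <= mu B)%E.
Proof.
move=> AB; apply: le_ereal_sup => _ [C [bC CA] <-]; exists C => //.
by split => //; exact: subset_trans AB.
Qed.

Lemma upper_variation_superadd A B : A `&` B = set0 ->
  (mu A + mu B <= mu (A `|` B))%E.
Proof.
move=> AB; apply: ereal_sup_superadd.
- by move=> _ [C _ <-]; rewrite ltNyr.
- by move=> _ [C _ <-]; rewrite ltNyr.
- by exists (rho set0)%:E, set0 => //; split => //; exact: bounded_borel0.
- by exists (rho set0)%:E, set0 => //; split => //; exact: bounded_borel0.
move=> _ _ [C [bC CA] <-] [D [bD DB] <-].
apply: ereal_sup_ubound; exists (C `|` D).
  by split; [exact: bounded_borelU|exact: setUSS].
rewrite -EFinD loc_additiveU//; apply/seteqP; split => // x [/CA Ax /DB Bx].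
by rewrite -AB.
Qed.

Lemma upper_variation_subadd F : (forall n, measurable (F n)) ->
  trivIset setT F ->
  (mu (\bigcup_n F n) <= \sum_(0 <= n <oo) mu (F n))%E.
Proof.
move=> mF tF; apply: ge_ereal_sup => _ [B [bB BF] <-].
have BE : B = \bigcup_n (B `&` F n) by rewrite -setI_bigcupr; apply/esym/setIidl.
have mB : measurable B by case: bB.
have bBF n : bounded_borel (B `&` F n).
  by apply: subset_bounded_borel bB => //; exact: measurableI.
have /= := rhoP.2 (fun n => B `&` F n).
rewrite -BE => /(_ _ bB) h.
have {}h : (\sum_(k < n) rho (B `&` F k))%:E @[n --> \oo] --> (rho B)%:E.
  apply: cvg_EFin; first exact: nearW.
  apply: h; first by move=> n; exact: measurableI.
  by apply: trivIset_setIl.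
rewrite -(cvg_lim _ h)//; apply: lee_lim.
- by apply/cvg_ex; eexists; exact: h.
- by apply: is_cvg_nneseries => *; exact: upper_variation_ge0.
apply: nearW => n; rewrite -sumEFin big_mkord; apply: lee_sum => k _.
by apply: ereal_sup_ubound; exists (B `&` F k).
Qed.

Lemma upper_variation_semi_sigma_additive : semi_sigma_additive mu.
Proof.
apply: semi_sigma_additive_of.
- exact: upper_variation0.
- exact: upper_variation_ge0.
- exact: le_upper_variation.
- by move=> A B _ _; exact: upper_variation_superadd.
- exact: upper_variation_subadd.
Qed.

End upper_variation.

Section total_variation.
Context (nu : localComplexMeasure R).
Local Notation normc := ComplexField.Normc.normc.
Local Notation mu := (total_variation nu).

Lemma normc_ge0 (z : R[i]) : 0 <= normc z.
Proof. by case: z => a b; exact: sqrtr_ge0. Qed.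

Let cst0_fam A : [/\ forall n : nat, bounded_borel (cst set0 n : set R),
  forall n : nat, (cst set0 n : set R) `<=` A &
  trivIset setT (cst set0 : nat -> set R)].
Proof.
split; [by move=> n; exact: bounded_borel0|by move=> n; exact: sub0set|].
by apply/trivIsetP => i j _ _ _; rewrite /cst set0I.
Qed.

Let term_ge0 A : (0 <= (normc (nu A))%:E)%E.
Proof. by rewrite lee_fin normc_ge0. Qed.

Lemma total_variation_ge0 A : (0 <= mu A)%E.
Proof.
apply: ereal_sup_ubound; exists (cst set0); first exact: cst0_fam.
apply: eseries0 => n _ _.
by rewrite /cst lcm0 ComplexField.Normc.normc0.
Qed.

Lemma total_variation0 : mu set0 = 0%E.
Proof.
apply/eqP; rewrite eq_le total_variation_ge0 andbT.
apply: ge_ereal_sup => _ [F [_ F0 _] <-].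
rewrite eseries0// => n _ _.
have -> : F n = set0 by rewrite -subset0; exact: F0.
by rewrite lcm0 ComplexField.Normc.normc0.
Qed.

Lemma le_total_variation A B : A `<=` B -> (mu A <= mu B)%E.
Proof.
move=> AB; apply: le_ereal_sup => _ [F [bF FA tF] <-]; exists F => //.
by split => // n; exact: subset_trans AB.
Qed.

Lemma total_variation_superadd A B : A `&` B = set0 ->
  (mu A + mu B <= mu (A `|` B))%E.
Proof.
move=> AB; apply: ereal_sup_superadd.
- move=> _ [F _ <-]; rewrite (@lt_le_trans _ _ 0%E)//.
  exact: nneseries_ge0.
- move=> _ [F _ <-]; rewrite (@lt_le_trans _ _ 0%E)//.
  exact: nneseries_ge0.
- by eexists; exists (cst set0); [exact: cst0_fam|reflexivity].
- by eexists; exists (cst set0); [exact: cst0_fam|reflexivity].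
move=> _ _ [F [bF FA tF] <-] [G [bG GB tG] <-].
rewrite -nneseriesD//.
pose H n := if odd n then G n./2 else F n./2.
apply: (@le_trans _ _ (\sum_(0 <= n <oo) (normc (nu (H n)))%:E)%E); last first.
  apply: ereal_sup_ubound; exists H => //; split.
  - by move=> n; rewrite /H; case: ifP.
  - move=> n; rewrite /H; case: ifP => _; [apply: subset_trans (GB _) _|apply: subset_trans (FA _) _].
      exact: subsetUr.
    exact: subsetUl.
  - apply/trivIsetP => i j _ _ ij; rewrite /H.
    have AB0 k l : F k `&` G l = set0.
      apply/seteqP; split => // x [/FA Ax /GB Bx]; by rewrite -AB.
    case: ifPn => oi; case: ifPn => oj.
    - apply: (trivIsetP.1 tG) => //; apply: contra ij => /eqP e.
      by rewrite -(odd_double_half i) -(odd_double_half j) oi oj e.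
    - by rewrite setIC.
    - by [].
    - apply: (trivIsetP.1 tF) => //; apply: contra ij => /eqP e.
      by rewrite -(odd_double_half i) -(odd_double_half j) (negbTE oi) (negbTE oj) e.
apply: lime_le; first by apply: is_cvg_nneseries => *; rewrite adde_ge0.
apply: nearW => n.
have -> : (\sum_(0 <= k < n) ((normc (nu (F k)))%:E + (normc (nu (G k)))%:E) =
   \sum_(0 <= k < n.*2) (normc (nu (H k)))%:E)%E.
  elim: n => [|n IH]; first by rewrite !big_geq.
  rewrite doubleS !big_nat_recr//= IH -addeA /H/= odd_double/=.
  by rewrite doubleK uphalf_double.
exact: nneseries_lim_ge.
Qed.

Lemma total_variation_subadd F : (forall n, measurable (F n)) ->
  trivIset setT F ->
  (mu (\bigcup_n F n) <= \sum_(0 <= n <oo) mu (F n))%E.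
Proof.
move=> mF tF; apply: ge_ereal_sup => _ [H [bH HF tH] <-].
have mH n : measurable (H n) by case: (bH n).
have bHF j k : bounded_borel (H j `&` F k).
  by apply: subset_bounded_borel (bH j) => //; exact: measurableI.
apply: (@le_trans _ _ (\sum_(0 <= j <oo) \sum_(0 <= k <oo)
    (normc (nu (H j `&` F k)))%:E)%E).
  apply: lee_nneseries => // j _.
  have HE : H j = \bigcup_k (H j `&` F k).
    by rewrite -setI_bigcupr; apply/esym/setIidl.
  have /= := @lcm_cvg nu (fun k => H j `&` F k).
  rewrite -HE => /(_ _ (bH j)) h.
  have /cvg_normc {}h : (\sum_(k < n) nu (H j `&` F k) : R[i]^o) @[n --> \oo]
     --> (nu (H j) : R[i]^o).
    apply: h; first by move=> n; exact: measurableI.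
    by apply: trivIset_setIl.
  apply/lee_addgt0Pr => e e0.
  have [n _ /(_ n (leqnn n)) hn] := h e e0.
  apply: (@le_trans _ _ ((\sum_(k < n) normc (nu (H j `&` F k)) + e)%:E)%E).
    rewrite lee_fin.
    have -> : nu (H j) = \sum_(k < n) nu (H j `&` F k)
        + (nu (H j) - \sum_(k < n) nu (H j `&` F k)) by rewrite addrC subrK.
    apply: (le_trans (le_normcD _ _)); rewrite lerD// ?(ltW hn)//.
    elim/big_ind2 : _ => //; first by rewrite ComplexField.Normc.normc0.
    move=> a b c d ab cd; apply: (le_trans (le_normcD _ _)); exact: lerD.
  rewrite EFinD leeD2r// -sumEFin -(big_mkord xpredT (fun k => (normc (nu (H j `&` F k)))%:E)).
  exact: nneseries_lim_ge.
rewrite nneseries_interchange//; apply: lee_nneseries.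
  by move=> k _ _; exact: nneseries_ge0.
move=> k _; apply: ereal_sup_ubound; exists (fun j => H j `&` F k) => //.
split; [by move=> j; exact: bHF|by move=> j; exact: subIsetr|].
by apply: trivIset_setIr.
Qed.

Lemma total_variation_semi_sigma_additive : semi_sigma_additive mu.
Proof.
apply: semi_sigma_additive_of.
- exact: total_variation0.
- exact: total_variation_ge0.
- exact: le_total_variation.
- by move=> A B _ _; exact: total_variation_superadd.
- exact: total_variation_subadd.
Qed.

End total_variation.
End measure_proofs.

Section measure_instances.
Context (R : realType) (nu : localComplexMeasure R).

HB.instance Definition _ := isMeasure.Build _ _ _ (total_variation nu)
  (total_variation0 nu) (total_variation_ge0 nu)
  (@total_variation_semi_sigma_additive R nu).

Let reP := lcm_Re nu.
Let reN := loc_sigma_additiveN reP.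
Let imP := lcm_Im nu.
Let imN := loc_sigma_additiveN imP.

HB.instance Definition _ := isMeasure.Build _ _ _ (re_pos nu)
  (upper_variation0 reP) (upper_variation_ge0 reP)
  (upper_variation_semi_sigma_additive reP).
HB.instance Definition _ := isMeasure.Build _ _ _ (re_neg nu)
  (upper_variation0 reN) (upper_variation_ge0 reN)
  (upper_variation_semi_sigma_additive reN).
HB.instance Definition _ := isMeasure.Build _ _ _ (im_pos nu)
  (upper_variation0 imP) (upper_variation_ge0 imP)
  (upper_variation_semi_sigma_additive imP).
HB.instance Definition _ := isMeasure.Build _ _ _ (im_neg nu)
  (upper_variation0 imN) (upper_variation_ge0 imN)
  (upper_variation_semi_sigma_additive imN).

End measure_instances.

Section zeta.
Context (R : realType).
Implicit Types nu : localComplexMeasure R.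

(* x ^ s = exp (s * ln x), for x > 0. *)
Definition cpow (x : R) (s : R[i]) : R[i] :=
  (x `^ complex.Re s)%:C *
  (cos (complex.Im s * ln x) +i* sin (complex.Im s * ln x)).

(* Meaningful when f is integrable for the total variation of nu. *)
Definition complex_integral nu (f : R -> R[i]) : R[i] :=
  let int (u : R -> R) :=
    (\int[re_pos nu]_(x in `]0, +oo[) u x - \int[re_neg nu]_(x in `]0, +oo[) u x)
    +i* (\int[im_pos nu]_(x in `]0, +oo[) u x - \int[im_neg nu]_(x in `]0, +oo[) u x)
  in int (fun x => complex.Re (f x)) + 'i%C * int (fun x => complex.Im (f x)).

Definition lcm_dimension nu : \bar R :=
  ereal_inf [set sigma%:E | sigma in [set sigma : R |
    (\int[total_variation nu]_(x in `]0%R, +oo[) (x `^ (- sigma))%:E < +oo)%E]].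

Definition geometric_zeta nu (s : R[i]) : R[i] :=
  complex_integral nu (fun x => cpow x (- s)).

(* [derivable] over the normed field R[i]: complex differentiability. *)
Definition holomorphic_at (f : R[i] -> R[i]) (p : R[i]) : Prop :=
  \forall s \near (p : R[i]^o), derivable (f : R[i]^o -> R[i]^o) s 1.

Definition pole_at (f : R[i] -> R[i]) (p : R[i]) : Prop :=
  exists (n : nat) (h : R[i] -> R[i]),
    [/\ (0 < n)%N, holomorphic_at h p, h p != 0 &
        \forall s \near (p : R[i]^o)^', f s = h s / (s - p) ^+ n].

(* The value of f at a pole is irrelevant; poles are automatically isolated. *)
Definition meromorphic (f : R[i] -> R[i]) : Prop :=
  forall p, holomorphic_at f p \/ pole_at f p.

(* Z = f / h as meromorphic functions: the zeros of h must form a discrete set. *)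
Definition meromorphic_quotient (Z f h : R[i] -> R[i]) : Prop :=
  (forall p, \forall s \near (p : R[i]^o)^', h s != 0) /\
  (forall s, h s != 0 -> Z s = f s / h s).

End zeta.

Section self_similar_strings.
Context (R : realType) (K N : nat).

Definition word_prod (T : pzSemiRingType) (a : 'I_N -> T) (J : seq 'I_N) : T :=
  \prod_(j <- J) a j.

(* \1_A x is the Dirac mass at x evaluated at A; when A is bounded, all but
   finitely many words contribute 0 to the sum over J. *)
Definition string_fun (g : 'I_K -> R) (r : 'I_N -> R) (m : 'I_N -> R[i])
    (A : set R) : R[i] :=
  \sum_(k < K) \sum_(J \in [set: seq 'I_N])
    word_prod m J * (\1_A ((g k)^-1 * (word_prod r J)^-1))%:C.

Lemma near_eq_sum (V : nmodType) (I : Type) (s : seq I) (f : nat -> I -> V)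
    (h : I -> V) : (forall i, \forall n \near \oo, f n i = h i) ->
  \forall n \near \oo, \sum_(i <- s) f n i = \sum_(i <- s) h i.
Proof.
move=> fh; elim: s => [|i s IH]; first by apply: nearW => n; rewrite !big_nil.
by apply: filterS2 (fh i) IH => n fi IH; rewrite !big_cons fi IH.
Qed.

Lemma near_sum_indic (F : nat -> set R) (x : R) : trivIset setT F ->
  \forall n \near \oo,
    \sum_(i < n) (\1_(F i) x : R) = \1_(\bigcup_i F i) x :> R.
Proof.
move=> tF; have [[i _ Fix]|nFx] := pselect ((\bigcup_i F i) x); last first.
  apply: nearW => n; rewrite [RHS]indicE memNset// big1// => i _.
  by rewrite indicE memNset// => Fix; apply: nFx; exists i.
exists i.+1 => // n /= ilen; rewrite [RHS]indicE mem_set; last by exists i.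
rewrite (bigD1 (Ordinal ilen))//= indicE mem_set// big1 ?addr0// => j ji.
rewrite indicE memNset// => Fjx; move/eqP: ji; apply; apply/val_inj => /=.
by apply: (tF _ _ Logic.I Logic.I); exists x.
Qed.

Lemma word_prod_le (r : 'I_N -> R) (rho : R) (J : seq 'I_N) :
  (forall j, 0 < r j <= rho) -> 0 < word_prod r J <= rho ^+ size J.
Proof.
move=> rr; rewrite /word_prod; elim: J => [|j J /andP[IH1 IH2]].
  by rewrite big_nil ltr01 lexx.
have /andP[r1 r2] := rr j.
by rewrite big_cons exprS mulr_gt0//= ler_pM// ltW.
Qed.

Lemma finite_words (r : 'I_N -> R) (c : R) : (forall j, 0 < r j < 1) ->
  0 < c -> finite_set [set J : seq 'I_N | c <= word_prod r J].
Proof.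
move=> r01 c0; pose rho := \big[Num.max/2^-1]_(j < N) r j.
have rho0 : 0 < rho by rewrite (@lt_le_trans _ _ 2^-1)//; exact: bigmax_ge_id.
have rho1 : rho < 1.
  apply/bigmax_ltP; split; first by rewrite invf_lt1// ltr1n.
  by move=> j _; case/andP: (r01 j).
have rr j : 0 < r j <= rho.
  by case/andP: (r01 j) => -> _ /=; exact: le_bigmax.
have : (rho ^+ n)%R @[n --> \oo] --> 0 by apply: cvg_expr; rewrite gtr0_norm.
move=> /cvgrPdist_lt/(_ _ c0)[n0 _ hn].
apply: (@sub_finite_set _ _ (\bigcup_(n in `I_n0) range (@tval n 'I_N))).
  move=> J /= cJ; exists (size J); last by exists (in_tuple J).
  rewrite /= ltnNge; apply/negP => /hn; rewrite sub0r normrN gtr0_norm ?exprn_gt0//.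
  case/andP: (word_prod_le J rr) => _ /(le_trans cJ) /le_lt_trans h /h.
  by rewrite ltxx.
apply: bigcup_finite => // n _; exact/finite_image/finite_finset.
Qed.

Lemma string_funE g r m (b : R) : (forall k, 0 < g k) ->
    (forall j, 0 < r j < 1) ->
  exists s : 'I_K -> seq (seq 'I_N), forall A : set R, A `<=` [set` `]0, b] ] ->
    string_fun g r m A = \sum_(k < K) \sum_(J <- s k)
      word_prod m J * (\1_A ((g k)^-1 * (word_prod r J)^-1))%:C.
Proof.
move=> g0 r01; have [b0|b0] := leP b 0.
  exists (fun=> [::]) => A Ab; apply: eq_bigr => k _.
  rewrite big_nil fsbig1// => J _; rewrite indicE memNset ?mulr0// => /Ab.
  by rewrite /= in_itv/= => /andP[/lt_le_trans h /h]; rewrite ltNge b0.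
have fk k : finite_set [set J : seq 'I_N | (g k * b)^-1 <= word_prod r J].
  by apply: finite_words => //; rewrite invr_gt0 mulr_gt0.
have [s sE] := choice (fun k => (finite_seqP _).1 (fk k)).
exists (fun k => undup (s k)) => A Ab; apply: eq_bigr => k _.
rewrite (fsbigE (undup (s k)))/= ?undup_uniq//.
- by apply: eq_bigl => J; rewrite in_setT.
- move=> J _ Jk; rewrite indicE memNset ?mulr0// => /Ab.
  rewrite /= in_itv/= => /andP[_ h]; move/negP: Jk; apply.
  rewrite mem_undup; suff : [set` s k] J by [].
  rewrite -sE/=.
  have r1 j : 0 < r j <= 1 by case/andP: (r01 j) => -> /ltW ->.
  have /andP[rJ _] := word_prod_le J r1.
  rewrite invf_ple ?posrE ?mulr_gt0//.
  by rewrite -(@ler_pM2l _ (g k)^-1) ?invr_gt0// mulKf ?gt_eqF.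
Qed.

Lemma string_fun_local g r m : (forall k, 0 < g k) -> (forall j, 0 < r j < 1) ->
  forall i : interval R, [set` i] `<=` `]0, +oo[ -> bounded_set [set` i] ->
    complex_measure_on [set` i] (string_fun g r m).
Proof.
move=> g0 r01 i i0 bi; split.
  rewrite /string_fun big1// => k _; rewrite fsbig1// => J _.
  by rewrite indic0 mulr0.
move=> F mF Fi tF.
have [b ib] : exists b : R, [set` i] `<=` [set` `]0, b] ].
  by apply: bounded_borelP; split.
have [s sE] := string_funE m b g0 r01.
rewrite sE; last by apply: bigcup_sub => n _; exact: subset_trans (Fi n) ib.
apply: cvg_near_cst.
have : \forall n \near \oo, \sum_(k < K) \sum_(J <- s k)
   word_prod m J * (\sum_(j < n) (\1_(F j) ((g k)^-1 * (word_prod r J)^-1) : R))%:C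
  = \sum_(k < K) \sum_(J <- s k)
   word_prod m J * (\1_(\bigcup_j F j) ((g k)^-1 * (word_prod r J)^-1))%:C.
  apply: near_eq_sum => k; apply: near_eq_sum => J.
  apply: filterS (near_sum_indic ((g k)^-1 * (word_prod r J)^-1) tF).
  by move=> n ->.
apply: filterS => n <-.
under eq_bigr do rewrite (sE _ (subset_trans (Fi _) ib)).
rewrite exchange_big/=; apply: eq_bigr => k _.
rewrite exchange_big/=; apply: eq_bigr => J _.
by rewrite -mulr_sumr raddf_sum.
Qed.

Definition self_similar_string g r m (hg : forall k, 0 < g k)
    (hr : forall j, 0 < r j < 1) : localComplexMeasure R :=
  LocalComplexMeasure (string_fun_local m hg hr).

End self_similar_strings.

(* Main.v *)
Require Import Defs.
From mathcomp Require Import ring lra measurable_realfun.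

(* With h(s) = 1 - sum_j m_j r_j^s, the string satisfies
     eta = sum_k delta_{1/g_k} + sum_j m_j (eta dilated by 1/r_j),
   because a nonempty word is a letter followed by a word.  Integrating x^-s against this
   identity over ]0, b], where all sums are finite, and letting b tend to infinity by
   dominated convergence gives zeta(s) h(s) = sum_k g_k^s on the whole half-plane
   Re s > D, even when cancellations make D smaller than the abscissa at which the sum
   over words converges absolutely; no analytic continuation is involved.  Numerator and
   denominator are exponential sums; a Taylor bound for exp factors each of them as
   (s - p)^n F(s) with F holomorphic near p, which gives the meromorphy of the quotient.
   At a zero p of h with Re p > D, continuity of zeta along p + 1/n identifies zeta(p)
   with the limit of the quotient. *)

Local Notation normc := ComplexField.Normc.normc.

(** * The complex exponential *)

Section complex_exponential.
Context (R : realType).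
Implicit Types (z w c : R[i]) (x y t : R).

Definition cexp z : R[i] :=
  (expR (complex.Re z))%:C * (cos (complex.Im z) +i* sin (complex.Im z)).

Lemma cexp0 : cexp 0 = 1.
Proof. by rewrite /cexp/= expR0 cos0 sin0 mul1r. Qed.

Lemma cexpD z w : cexp (z + w) = cexp z * cexp w.
Proof.
case: z w => a b [e f]; rewrite /cexp/= expRD cosD sinD.
by apply/eqP; rewrite eq_complex/=; apply/andP; split; apply/eqP; ring.
Qed.

Lemma cpowE x s : 0 < x -> cpow x s = cexp ((ln x)%:C * s).
Proof.
case: s => a b x0; rewrite /cpow /cexp/= /powR gt_eqF//.
by rewrite !mul0r subr0 addr0 [ln x * a]mulrC [ln x * b]mulrC.
Qed.

Definition cexp_rem n z : R[i] := cexp z - \sum_(k < n) z ^+ k / k`!%:R.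

Lemma cexp_rem0 n : cexp_rem n.+1 0 = 0.
Proof.
rewrite /cexp_rem big_ord_recl/= expr0 cexp0 divr1 big1 ?addr0 ?subrr// => i _.
by rewrite /bump/= add1n expr0n/= mul0r.
Qed.

Lemma cexp_remS n z : cexp_rem n z = z ^+ n / n`!%:R + cexp_rem n.+1 z.
Proof. by rewrite /cexp_rem big_ord_recr/=; ring. Qed.

(* Inserting the factor c makes the family of real functions
   t |-> Re (c * cexp_rem n (t z)) stable under differentiation. *)
Let rem_curve n c z t := complex.Re (c * cexp_rem n (t%:C * z)).

(** Written out in real terms, the curve is a product of a real exponential with a combination of
    cosine and sine, and differentiating it multiplies c by z. *)
Let rem_curve_is_derive0 c z t :
  is_derive t 1 (rem_curve 0 c z) (rem_curve 0 (c * z) z t).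
Proof.
case: c z => a b [x y].
have -> : rem_curve 0 (a +i* b) (x +i* y) =
   (fun t => expR (t * x) * (a * cos (t * y) - b * sin (t * y))).
  apply/funext => u; rewrite /rem_curve /cexp_rem big_ord0 subr0 /cexp/=.
  by rewrite !mul0r !subr0 !addr0; ring.
apply: is_derive_eq.
rewrite /rem_curve /cexp_rem big_ord0 subr0 /cexp/= /GRing.scale/=.
by rewrite !mul0r !subr0 !addr0; ring.
Qed.

Let rem_curveS n c z t :
  rem_curve n.+1 c z t = rem_curve n c z t - t ^+ n * complex.Re (c * z ^+ n / n`!%:R).
Proof.
rewrite /rem_curve [cexp_rem n _]cexp_remS.
move: (cexp_rem n.+1 _) => w; rewrite mulrDr.
have -> : c * ((t%:C * z) ^+ n / n`!%:R) = (t ^+ n)%:C * (c * z ^+ n / n`!%:R).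
  by rewrite exprMn -rmorphXn/=; ring.
case: (c * z ^+ n / _) => u v; case: (c * w) => u' v' /=.
ring.
Qed.

(** Induction on the order: the two curves of consecutive orders differ by a monomial in t, whose
    derivative is the monomial removed one order lower, with c replaced by c z. *)
Let rem_curve_is_derive n c z t :
  is_derive t 1 (rem_curve n.+1 c z) (rem_curve n (c * z) z t).
Proof.
elim: n t => [|n IH] t.
  have -> : rem_curve 1 c z = rem_curve 0 c z - cst (complex.Re c).
    apply/funext => u; rewrite rem_curveS /cst/= fctE.
    by rewrite !expr0 mul1r divr1 mulr1.
  have := rem_curve_is_derive0 c z t => ?.
  by apply: is_derive_eq; rewrite subr0.
have -> : rem_curve n.+2 c z = rem_curve n.+1 c z -
    complex.Re (c * z ^+ n.+1 / n.+1`!%:R) \*: (@id R ^+ n.+1 : R -> R).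
  by apply/funext => u; rewrite rem_curveS mulrC !fctE.
have IHt := IH t.
apply: is_derive_eq.
rewrite rem_curveS; congr (_ - _).
rewrite /GRing.scale/= mulr1.
have -> : c * z ^+ n.+1 / n.+1`!%:R = (n.+1%:R^-1)%:C * (c * z * z ^+ n / n`!%:R).
  rewrite exprS factS natrM invfM fmorphV rmorph_nat/=; ring.
case: (c * z * _ / _) => u v /=; rewrite mul0r subr0.
field.
by rewrite nat1r pnatr_eq0.
Qed.


Lemma normc_cexp z : normc (cexp z) = expR (complex.Re z).
Proof.
rewrite /cexp ComplexField.Normc.normcM.
rewrite /= [X in _ * X](_ : _ = 1) ?mulr1; last by rewrite cos2Dsin2 sqrtr1.
by rewrite expr0n addr0 sqrtr_sqr ger0_norm// expR_ge0.
Qed.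

(** A curve of order n + 1 vanishes at 0, so the mean value theorem expresses it by the curve of
    order n for c z; each such step gains a factor |z|. At order 0, the modulus of exp (t z) is at
    most e. *)
Let rem_curve_le n c z t : normc z <= 1 -> 0 <= t <= 1 ->
  `|rem_curve n c z t| <= expR 1 * normc c * normc z ^+ n.
Proof.
move=> z1; elim: n c t => [|n IH] c t /andP[t0 t1].
  rewrite expr0 mulr1 /rem_curve (le_trans (normc_Re _))//.
  rewrite ComplexField.Normc.normcM mulrC ler_wpM2r ?normc_ge0//.
  rewrite /cexp_rem big_ord0 subr0 normc_cexp ler_expR.
  have : `|complex.Re z| <= 1 by rewrite (le_trans (normc_Re _)).
  case: z {z1} => x y /=; rewrite mul0r subr0 ler_norml => /andP[_ x1].
  by have [x0|x0] := leP 0 x; [exact: mulr_ile1|nra].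
have [xi xi0t eq] := MVT_segment t0
  (fun x _ => rem_curve_is_derive n c z x)
  (derivable_within_continuous (fun x _ => @ex_derive _ _ _ _ _ _ _ (rem_curve_is_derive n c z x))).
have rc0 : rem_curve n.+1 c z 0 = 0.
  by rewrite /rem_curve mul0r cexp_rem0 mulr0.
move: eq; rewrite rc0 !subr0 => ->.
move: xi0t; rewrite in_itv/= => /andP[xi0 xit].
rewrite normrM (ger0_norm t0) exprS mulrA -[_ * normc z]mulrA.
rewrite -ComplexField.Normc.normcM.
apply: le_trans (IH (c * z) xi _); last by rewrite xi0 (le_trans xit).
by rewrite ler_piMr.
Qed.

(** The choices c = 1 and c = -i extract the real and the imaginary part of the remainder; the
    factor 2 comes from |w| <= |Re w| + |Im w|. *)
Lemma normc_cexp_rem n z : normc z <= 1 ->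
  normc (cexp_rem n z) <= expR 1 * 2 * normc z ^+ n.
Proof.
move=> z1.
have h c : `|complex.Re (c * cexp_rem n z)| <= expR 1 * normc c * normc z ^+ n.
  have := @rem_curve_le n c z 1 z1.
  by rewrite /rem_curve mul1r; apply; rewrite ler01 lexx.
have := h 1; have := h (0 -i* 1).
rewrite mul1r /= expr0n expr1n !add0r addr0 sqrrN expr1n sqrtr1 !mulr1.
case: (cexp_rem n z) => u v /=; rewrite mul0r mulN1r opprK add0r => hv hu.
rewrite mulrC mulrA [_ * 2]mulrC mulrA [_ * expR 1]mulrC.
apply: le_trans (_ : `|u| + `|v| <= _); last by lra.
rewrite -(@ler_pXn2r _ 2) ?nnegrE ?sqrtr_ge0 ?addr_ge0//.
rewrite sqr_sqrtr ?addr_ge0 ?sqr_ge0// -[u ^+ 2]real_normK ?num_real//.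
rewrite -[v ^+ 2]real_normK ?num_real// sqrrD.
by rewrite -addrA [_ *+ 2 + _]addrC addrA lerDl mulrn_wge0// mulr_ge0.
Qed.

End complex_exponential.

(** * Exponential sums and their quotients *)

(** The difference quotient is within C |h| of L. This criterion turns Taylor bounds into
    differentiability over the field itself, hence into complex differentiability over [R[i]]. *)
Lemma quadratic_approx_derivable (K : numFieldType) (f : K^o -> K^o) (p L C : K) :
  0 <= C ->
  (\forall s \near (p : K^o), `|f s - f p - L * (s - p)| <= C * `|s - p| ^+ 2) ->
  derivable f p 1.
Proof.
move=> C0 H; apply/cvg_ex; exists (L : K^o).
apply/cvgrPdist_lt => e e0.
have {}H : \forall h \near (0 : K^o)^',
    `|f (h + p) - f p - L * h| <= C * `|h| ^+ 2.
  apply: nbhs_dnbhs.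
  by move/nbhs0P : H; apply: filterS => h; rewrite [p + h]addrC addrK.
near=> h.
have h0 : h != 0 by near: h; exact: nbhs_dnbhs_neq.
rewrite /GRing.scale/= mulr1.
have -> : L - h^-1 * (f (h + p) - f p) = - (h^-1 * (f (h + p) - f p - L * h)).
  by field.
rewrite normrN normrM normfV ltr_pdivrMl ?normr_gt0//.
apply: (@le_lt_trans _ _ (C * `|h| ^+ 2)); first by near: h.
rewrite expr2 mulrCA ltr_pM2l ?normr_gt0//.
(* C + 1 is positive even when C = 0, so that it can be divided by. *)
apply: (@le_lt_trans _ _ ((C + 1) * `|h|)); first by rewrite ler_wpM2r// lerDl.
rewrite -ltr_pdivlMl ?ltr_wpDl// mulrC.
by near: h; apply: dnbhs0_lt; rewrite divr_gt0// ltr_wpDl.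
Unshelve. all: by end_near. Qed.

Lemma near_dist_le (K : numFieldType) (p e : K) : 0 < e ->
  \forall s \near (p : K^o), `|p - s| <= e.
Proof.
move=> e0; have := @cvg_id _ (nbhs (p : K^o)).
by move/(@cvgrPdist_le _ K^o _ _ _ id p); apply.
Qed.

Lemma near_sub_neq0 (K : numFieldType) (p q : K) : p - q != 0 ->
  \forall s \near (p : K^o), s - q != 0.
Proof.
move=> pq; have pq0 : 0 < `|p - q| / 2 by rewrite divr_gt0// normr_gt0.
apply: filterS (near_dist_le p pq0) => s sp; apply: contraTneq sp => /eqP.
rewrite subr_eq0 => /eqP ->.
by rewrite lt_geF// ltr_pdivrMr// mulr_natr mulr2n ltrDl normr_gt0.
Qed.

Lemma derivable_subX (K : numFieldType) (p s : K) n :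
  derivable (fun t : K^o => (t - p) ^+ n : K^o) s 1.
Proof.
elim: n => [|n IH]; first exact: derivable_cst.
have -> : (fun t : K^o => (t - p) ^+ n.+1 : K^o) =
    (fun t : K^o => t - p : K^o) * (fun t : K^o => (t - p) ^+ n : K^o).
  by apply/funext => t; rewrite exprS.
apply: derivableM IH.
apply: (@quadratic_approx_derivable _ _ s 1 0) => //.
apply: (@filterE _ (nbhs (s : K^o))) => t.
by rewrite (_ : _ - _ = 0) ?normr0 ?mul0r//; ring.
Qed.

(** * Stability properties of holomorphy *)

Section holomorphy.
Context (R : realType).
Implicit Types (f h : R[i] -> R[i]) (p s z : R[i]).

Lemma near_holomorphic_at f h p : (\forall s \near (p : R[i]^o), f s = h s) ->
  holomorphic_at h p -> holomorphic_at f p.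
Proof.
move=> fh hh; rewrite /holomorphic_at; near=> s.
have : derivable (h : R[i]^o -> R[i]^o) s 1 by near: s; exact: hh.
apply: near_eq_derivable.
(* Equality near p is equality near every s close enough to p, as derivability at s requires. *)
have : \forall t \near (s : R[i]^o), f t = h t by near: s; exact: nbhs_interior.
by apply: filterS => t ->.
Unshelve. all: by end_near. Qed.

Lemma holomorphic_at_continuous f p : holomorphic_at f p ->
  (f s : R[i]^o) @[s --> (p : R[i]^o)] --> (f p : R[i]^o).
Proof.
move=> /nbhs_singleton df.
exact/differentiable_continuous/derivable1_diffP.
Qed.

Lemma holomorphic_at_div f h p : holomorphic_at f p -> holomorphic_at h p ->
  h p != 0 -> holomorphic_at (fun s => f s / h s) p.
Proof.
move=> hf hh hp.
have h0 : \forall s \near (p : R[i]^o), h s != 0.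
  exact: (@cvgr_neq0 _ R[i]^o _ _ _ h _ (holomorphic_at_continuous hh) hp).
apply: filterS3 hf hh h0 => s df dh hs.
exact: derivableM df (derivableV hs dh).
Qed.

End holomorphy.

(** * Taylor expansion and zeros of exponential sums *)

Section exponential_sums.
Context (R : realType) (I : finType) (c : I -> R[i]) (l : I -> R).
Implicit Types (p s z : R[i]).

(** Common form of numerator and denominator: the exponents are the ln (g k), respectively the ln (r
    j) together with 0 for the constant 1. *)
Definition exp_sum s : R[i] := \sum_i c i * cexp ((l i)%:C * s).

(** The Taylor coefficient of degree k at p. *)
Definition exp_sum_coef p k : R[i] :=
  \sum_i c i * cexp ((l i)%:C * p) * (l i)%:C ^+ k / k`!%:R.

Lemma exp_sum_coef0 p : exp_sum_coef p 0 = exp_sum p.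
Proof. by apply: eq_bigr => i _; rewrite expr0 divr1 mulr1. Qed.

Lemma norm_cexp_rem n z : `|z| <= 1 ->
  `|cexp_rem n z| <= (expR 1 * 2)%:C * `|z| ^+ n.
Proof.
move=> z1; have nE (w : R[i]) : `|w| = (ComplexField.Normc.normc w)%:C by [].
by rewrite !nE -rmorphXn/= -rmorphM/= lecR normc_cexp_rem// -lecR -nE.
Qed.

(** Factoring exp (l s) as exp (l p) exp (l (s - p)) reduces the expansion at p to that of the
    exponential at 0. *)
Lemma exp_sum_rem p s n : exp_sum s - \sum_(k < n) exp_sum_coef p k * (s - p) ^+ k =
  \sum_i c i * cexp ((l i)%:C * p) * cexp_rem n ((l i)%:C * (s - p)).
Proof.
rewrite /exp_sum /exp_sum_coef.
under [X in _ - X]eq_bigr do rewrite mulr_suml.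
rewrite exchange_big/= -sumrB; apply: eq_bigr => i _.
have -> : cexp ((l i)%:C * s) = cexp ((l i)%:C * p) * cexp ((l i)%:C * (s - p)).
  by rewrite -cexpD -mulrDr addrC subrK.
rewrite /cexp_rem [RHS]mulrBr mulrA; congr (_ - _).
rewrite mulr_sumr; apply: eq_bigr => k _; rewrite exprMn; ring.
Qed.

Lemma exp_sum_taylor p n : exists2 C : R[i], 0 <= C &
  \forall s \near (p : R[i]^o),
    `|exp_sum s - \sum_(k < n) exp_sum_coef p k * (s - p) ^+ k| <= C * `|s - p| ^+ n.
Proof.
(* L bounds every |l i|, so |s - p| <= 1 / (L + 1) keeps each l i (s - p) in the unit disc, where
   the bound for the exponential holds; the added 1 keeps the radius positive when L = 0. *)
pose L : R[i] := \sum_i `|(l i)%:C|.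
have lL i : `|(l i)%:C| <= L by rewrite /L (bigD1 i)//= lerDl sumr_ge0.
have L0 : 0 <= L by apply: sumr_ge0.
exists (\sum_i `|c i * cexp ((l i)%:C * p)| * ((expR 1 * 2)%:C * `|(l i)%:C| ^+ n)).
  by apply: sumr_ge0 => i _; rewrite !mulr_ge0// ?exprn_ge0// lecR mulr_ge0// expR_ge0.
have : \forall s \near (p : R[i]^o), `|p - s| <= (L + 1)^-1.
  have L1 : 0 < (L + 1)^-1 by rewrite invr_gt0 ltr_wpDl.
  exact: near_dist_le.
apply: filterS => s; rewrite distrC => sp.
rewrite exp_sum_rem (le_trans (ler_norm_sum _ _ _))// mulr_suml ler_sum// => i _.
rewrite normrM -[X in _ <= X]mulrA ler_wpM2l//.
rewrite -mulrA -exprMn -normrM norm_cexp_rem//.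
rewrite normrM (le_trans (ler_wpM2l _ sp))// ler_pdivrMr ?ltr_wpDl// mul1r.
by rewrite (le_trans (lL i))// lerDl.
Qed.

Lemma exp_sum_holomorphic p : holomorphic_at exp_sum p.
Proof.
apply: (@filterE _ (nbhs (p : R[i]^o))) => s; have [C C0 H] := exp_sum_taylor s 2.
apply: (@quadratic_approx_derivable _ _ s (exp_sum_coef s 1) C C0).
apply: filterS H => t; rewrite 2!big_ord_recr big_ord0/= expr0 expr1 add0r mulr1.
by rewrite exp_sum_coef0 opprD addrA.
Qed.

(** F is the quotient by (s - p)^n, with the gap at p filled by the coefficient of degree n. Away
    from p it is a quotient of holomorphic functions; at p the Taylor bound shows
    differentiability. *)
Lemma exp_sum_factor p n : (forall k, (k < n)%N -> exp_sum_coef p k = 0) ->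
  exists F : R[i] -> R[i], [/\ holomorphic_at F p, F p = exp_sum_coef p n &
    forall s, s != p -> exp_sum s = (s - p) ^+ n * F s].
Proof.
move=> a0; pose F s := if s == p then exp_sum_coef p n else exp_sum s / (s - p) ^+ n.
have Fp : F p = exp_sum_coef p n by rewrite /F eqxx.
have FE s : s != p -> exp_sum s = (s - p) ^+ n * F s.
  move=> sp; rewrite /F (negbTE sp) mulrC divfK//.
  by rewrite expf_neq0// subr_eq0.
exists F; split => //.
have dFp : derivable (F : R[i]^o -> R[i]^o) p 1.
  (* Two orders beyond n, so that dividing by (s - p)^n leaves a quadratic error; the derivative of
     F at p is the coefficient of degree n + 1. *)
  have [C C0 H] := exp_sum_taylor p n.+2.
  apply: (@quadratic_approx_derivable _ _ p (exp_sum_coef p n.+1) C C0).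
  apply: filterS H => s; have [->|sp] := eqVneq s p.
    by rewrite !subrr mulr0 subr0 normr0 mulr_ge0.
  rewrite !big_ord_recr/= big1 ?add0r; last by move=> i _; rewrite a0 ?mul0r.
  rewrite FE// Fp.
  have -> : (s - p) ^+ n * F s - (exp_sum_coef p n * (s - p) ^+ n +
      exp_sum_coef p n.+1 * (s - p) ^+ n.+1) =
    (s - p) ^+ n * (F s - exp_sum_coef p n - exp_sum_coef p n.+1 * (s - p)).
    by rewrite exprS; ring.
  rewrite normrM normrX -addn2 exprD mulrCA ler_pM2l// exprn_gt0// normr_gt0.
  by rewrite subr_eq0.
apply: (@filterE _ (nbhs (p : R[i]^o))) => s; have [->//|sp] := eqVneq s p.
have : derivable (fun t : R[i]^o => exp_sum t / (t - p) ^+ n : R[i]^o) (s : R[i]^o) 1.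
  have hX : holomorphic_at (fun t => (t - p) ^+ n) s.
    by apply: (@filterE _ (nbhs (s : R[i]^o))) => t; exact: derivable_subX.
  have sp0 : (s - p) ^+ n != 0 by rewrite expf_neq0// subr_eq0.
  have hd := @holomorphic_at_div _ exp_sum (fun t => (t - p) ^+ n) s (exp_sum_holomorphic s) hX sp0.
  exact (nbhs_singleton hd).
apply: near_eq_derivable.
have sp0 : s - p != 0 by rewrite subr_eq0.
have : \forall t \near (s : R[i]^o), t - p != 0.
  exact: near_sub_neq0.
by apply: filterS => t; rewrite subr_eq0 /F => /negbTE ->.
Qed.

(* Testing the power sums of the l i against \prod_(l j <> l i) ('X - l j) isolates
   the terms with exponent l i. *)
Lemma exp_sum_coef_neq0 p i0 :
  \sum_(i | l i == l i0) c i * cexp ((l i)%:C * p) != 0 ->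
  exists k, exp_sum_coef p k != 0.
Proof.
move=> c0; apply: contrapT => /forallNP H.
have {}H k : \sum_i c i * cexp ((l i)%:C * p) * (l i)%:C ^+ k = 0.
  have /negP := H k; rewrite negbK /exp_sum_coef -mulr_suml mulf_eq0 invr_eq0.
  by rewrite pnatr_eq0 gtn_eqF ?fact_gt0// orbF => /eqP.
pose P : {poly R[i]} := \prod_(j | l j != l i0) ('X - (l j)%:C%:P).
have PE z : P.[z] = \prod_(j | l j != l i0) (z - (l j)%:C).
  by rewrite horner_prod; apply: eq_bigr => j _; rewrite !hornerE.
have : \sum_i c i * cexp ((l i)%:C * p) * P.[(l i)%:C] = 0.
  under eq_bigr do rewrite horner_coef mulr_sumr.
  rewrite exchange_big/= big1// => k _.
  by under eq_bigr do rewrite mulrCA; rewrite -mulr_sumr H mulr0.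
rewrite (bigID (fun i => l i == l i0))/= [X in _ + X]big1 ?addr0; last first.
  by move=> i li; rewrite PE (bigD1 i)//= subrr mul0r mulr0.
under eq_bigr => i /eqP li do rewrite [in P.[_]]li.
rewrite -mulr_suml => /eqP; rewrite mulf_eq0 (negbTE c0)/= PE.
apply/negP; apply/prodf_neq0 => j lj; rewrite subr_eq0 eq_sym.
by apply: contra lj => /eqP/(fmorph_inj (real_complex R)) ->.
Qed.

End exponential_sums.

(** * Meromorphy of quotients of exponential sums *)

Section quotients.
Context (R : realType) (I J : finType).
Context (cf : I -> R[i]) (lf : I -> R) (ch : J -> R[i]) (lh : J -> R).
Implicit Types (p s : R[i]).
Local Notation f := (exp_sum cf lf).
Local Notation h := (exp_sum ch lh).

(** Choosing the least n with a nonzero coefficient makes F p nonzero: n is the order of vanishing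
    at p, and n = 0 means no zero there. *)
Lemma exp_sum_min_factor (I' : finType) (c : I' -> R[i]) (l : I' -> R) p :
  (exists k, exp_sum_coef c l p k != 0) ->
  exists n (F : R[i] -> R[i]), [/\ forall k, (k < n)%N -> exp_sum_coef c l p k = 0,
    holomorphic_at F p, F p = exp_sum_coef c l p n, F p != 0 &
    forall s, s != p -> exp_sum c l s = (s - p) ^+ n * F s].
Proof.
move=> ex; case: (ex_minnP ex) => n an nmin.
have a0 k : (k < n)%N -> exp_sum_coef c l p k = 0.
  by move=> kn; apply/eqP; apply: contraTT kn => /nmin; rewrite -leqNgt.
have [F [hF Fp FE]] := exp_sum_factor a0.
by exists n, F; split => //; rewrite Fp.
Qed.

Lemma near_neq0_of_holomorphic (F : R[i] -> R[i]) p : holomorphic_at F p -> F p != 0 ->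
  \forall s \near (p : R[i]^o)^', F s != 0 /\ s != p.
Proof.
move=> hF Fp.
have F0 : \forall s \near (p : R[i]^o), F s != 0.
  exact: (@cvgr_neq0 _ R[i]^o _ _ _ F _ (holomorphic_at_continuous hF) Fp).
by apply: filterS2 (nbhs_dnbhs F0) (@nbhs_dnbhs_neq R[i]^o p).
Qed.

Lemma exp_sum_isolated_zeros p : (exists k, exp_sum_coef ch lh p k != 0) ->
  \forall s \near (p : R[i]^o)^', h s != 0.
Proof.
move=> /exp_sum_min_factor[n [H [_ hH _ Hp HE]]].
apply: filterS (near_neq0_of_holomorphic hH Hp) => s [Hs sp].
by rewrite HE// mulf_neq0// expf_neq0// subr_eq0.
Qed.

(* At a zero of h the value of Z only matters when f / h has a removable
   singularity there. *)
Lemma meromorphic_exp_sum_quotient (Z : R[i] -> R[i]) :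
  (forall p, exists k, exp_sum_coef ch lh p k != 0) ->
  (forall s, h s != 0 -> Z s = f s / h s) ->
  (forall p (L : R[i]), h p = 0 ->
     (f s / h s : R[i]^o) @[s --> (p : R[i]^o)^'] --> (L : R[i]^o) -> Z p = L) ->
  meromorphic Z.
Proof.
move=> hne Zfh Zlim p.
have [n [H [H0 hH Hpn Hp HE]]] := exp_sum_min_factor (hne p).
have nH := near_neq0_of_holomorphic hH Hp.
(* Compare the orders of vanishing at p. If f vanishes to an order k' < n, then p is a pole of order
   n - k'. *)
have [[k kn ak]|noa] := pselect (exists2 k, (k < n)%N & exp_sum_coef cf lf p k != 0).
  have [k' [F [F0 hF Fpk Fp FE]]] := exp_sum_min_factor (ex_intro _ k ak).
  have k'n : (k' < n)%N.
    apply: leq_ltn_trans kn; rewrite leqNgt; apply: contra ak => /F0 ->.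
    by rewrite eqxx.
  right; exists (n - k')%N, (fun s => F s / H s); split.
  - by rewrite subn_gt0.
  - exact: holomorphic_at_div.
  - by rewrite mulf_neq0// invr_eq0.
  - apply: filterS nH => s [Hs sp].
    have sp0 : s - p != 0 by rewrite subr_eq0.
    rewrite Zfh; last by rewrite HE// mulf_neq0// expf_neq0.
    rewrite HE// FE// -{1}(subnK (ltnW k'n)) exprD; field.
    by rewrite Hs !expf_neq0.
(* Otherwise (s - p)^n divides f as well, and the quotient extends holomorphically as F / H; it
   remains to see that Z takes the right value at p. *)
have a0 k : (k < n)%N -> exp_sum_coef cf lf p k = 0.
  by move=> kn; apply: contrapT => /eqP ak; apply: noa; exists k.
have [F [hF Fp FE]] := exp_sum_factor a0.
have hFH := holomorphic_at_div hF hH Hp.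
have fhE s : H s != 0 /\ s != p -> f s / h s = F s / H s.
  move=> [Hs sp]; rewrite HE// FE//; field.
  by rewrite Hs expf_neq0// subr_eq0.
have hE s : H s != 0 /\ s != p -> h s != 0.
  by move=> [Hs sp]; rewrite HE// mulf_neq0// expf_neq0// subr_eq0.
left; apply: near_holomorphic_at (hFH).
have Zp : Z p = F p / H p.
  have [hp0|hp] := eqVneq (h p) 0.
    apply: Zlim => //.
    have : (F s / H s : R[i]^o) @[s --> (p : R[i]^o)^'] --> (F p / H p : R[i]^o).
      move=> A /(holomorphic_at_continuous hFH).
      exact: (@nbhs_dnbhs R[i]^o p).
    apply: cvg_trans; apply: near_eq_cvg.
    by apply: filterS nH => s /fhE.
  (* The coefficient of degree 0 is h p, so h p <> 0 forces n = 0, and F and H take the values f p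
     and h p. *)
  have n0 : n = 0%N.
    case: n H0 {HE FE a0 hE fhE noa Fp Hpn} => // n /(_ 0%N isT).
    by rewrite exp_sum_coef0 => /eqP; rewrite (negbTE hp).
  by rewrite Zfh// Fp Hpn n0 !exp_sum_coef0.
have {}nH : \forall s \near (p : R[i]^o), s != p -> H s != 0 /\ s != p := nH.
apply: filterS nH => s; have [->//|sp /(_ isT) [Hs _]] := eqVneq s p.
by rewrite -fhE// Zfh//; exact: hE.
Qed.

End quotients.

(** * Integration against a local complex measure *)

(** On D without s every measurable subset is null, so mu can be exchanged there for the zero
    measure; the rest is a finite disjoint union of singletons, on each of which f is constant. *)
Lemma integral_finite_support (d : measure_display) (T : measurableType d)
    (R : realType) (mu : {measure set T -> \bar R}) (D : set T) (s : seq T)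
    (f : T -> R) :
  measurable D -> (forall x : T, measurable [set x]) -> uniq s ->
  [set` s] `<=` D -> mu (D `\` [set` s]) = 0%E -> measurable_fun D f ->
  (\int[mu]_(x in D) (f x)%:E = \sum_(x <- s) (f x)%:E * mu [set x])%E.
Proof.
move=> mD m1 us sD muD mf.
have sE : [set` s] = \big[setU/set0]_(x <- s) [set x].
  by rewrite -bigcup_seq; apply/seteqP; split => [x xs|x [y ys ->]//]; exists x.
have ms : measurable [set` s] by rewrite sE; exact: bigsetU_measurable.
have mDs : measurable (D `\` [set` s]) by exact: measurableD.
rewrite -[in LHS](setDUK sD) [in LHS]setUC integral_setU//; last 2 first.
  by rewrite setUC setDUK//; exact/measurable_EFinP.
  by apply/disj_setPRL; rewrite setCD; exact: subsetUr.
rewrite [X in (X + _)%E](eq_measure_integral mzero) ?integral_measure_zero ?add0e; last first.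
  move=> A mA AD; apply: subset_measure0 muD => //.
rewrite sE integral_bigsetU_EFin//.
- apply: eq_bigr => x _; rewrite -integral_cst//; apply: eq_integral => y.
  by rewrite inE => ->.
- by move=> x y _ _ [z [-> ->]].
- by rewrite -sE; apply/measurable_EFinP; exact: measurable_funS mf.
Qed.

(** * Variation measures on points, and their comparison *)

Section variations.
Context (R : realType) (nu : localComplexMeasure R).
Implicit Types (A B : set R) (x : R).

(** The sequence B, empty, empty, ... competes in the supremum. *)
Lemma normc_le_total_variation A B : bounded_borel B -> B `<=` A ->
  ((normc (nu B))%:E <= total_variation nu A)%E.
Proof.
move=> bB BA; apply: (@le_trans _ _ (\sum_(0 <= n <oo) (normc (nu (bigcup2 B set0 n)))%:E)%E); last first.
  apply: ereal_sup_ubound; exists (bigcup2 B set0) => //; split.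
  - by case=> [|[|n]]//=; exact: bounded_borel0.
  - by case=> [|[|n]]//=.
  - by rewrite -trivIset_bigcup2 setI0.
have h n : (0 <= n)%N -> xpredT n -> (0 <= (normc (nu (bigcup2 B set0 n)))%:E)%E.
  by move=> _ _; rewrite lee_fin normc_ge0.
have := nneseries_lim_ge 1 h; apply: le_trans.
by rewrite big_nat1.
Qed.

(** Among disjoint subsets of a singleton at most one is nonempty, so every competing series has at
    most one nonzero term. *)
Lemma total_variation_set1 x : 0 < x ->
  total_variation nu [set x] = (normc (nu [set x]))%:E.
Proof.
move=> x0; have b1 : bounded_borel [set x].
  split => //; first by move=> _ ->; rewrite /= in_itv/= x0.
  by exists x; split; [exact: num_real|move=> M xM _ -> /=; rewrite gtr0_norm// ltW].
apply/eqP; rewrite eq_le normc_le_total_variation// andbT.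
apply: ge_ereal_sup => _ [F [bF F1 tF] <-].
have F01 n : F n = set0 \/ F n = [set x] by apply/subset_set1.
have [[n0 Fn0]|nF] := pselect (exists n, F n = [set x]); last first.
  rewrite eseries0 ?lee_fin ?normc_ge0// => n _ _.
  have [->|Fn] := F01 n; first by rewrite lcm0 ComplexField.Normc.normc0.
  by exfalso; apply: nF; exists n.
rewrite (nneseriesD1 (n := n0))//; last by move=> *; rewrite lee_fin normc_ge0.
rewrite Fn0 eseries0 ?adde0// => n _ /= nn0.
have [->|Fn] := F01 n; first by rewrite lcm0 ComplexField.Normc.normc0.
by move/eqP: nn0; case; apply: (tF _ _ Logic.I Logic.I); exists x; rewrite Fn Fn0.
Qed.

Lemma total_variation_eq0 A : (forall B, bounded_borel B -> B `<=` A -> nu B = 0) ->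
  total_variation nu A = 0%E.
Proof.
move=> nu0; apply/eqP; rewrite eq_le total_variation_ge0 andbT.
apply: ge_ereal_sup => _ [F [bF FA tF] <-]; rewrite eseries0// => n _ _.
by rewrite nu0// ComplexField.Normc.normc0.
Qed.

(** The supremum runs over the two subsets of the singleton only; the empty one contributes the 0 in
    the maximum. *)
Lemma upper_variation_set1 (rho : set R -> R) x : rho set0 = 0 -> 0 < x ->
  upper_variation rho [set x] = (Num.max (rho [set x]) 0)%:E.
Proof.
move=> r0 x0; have b1 : bounded_borel [set x].
  split => //; first by move=> _ ->; rewrite /= in_itv/= x0.
  by exists x; split; [exact: num_real|move=> M xM _ -> /=; rewrite gtr0_norm// ltW].
apply/eqP; rewrite eq_le; apply/andP; split.
  apply: ge_ereal_sup => _ [B [_ /subset_set1[]-> <-]]; rewrite lee_fin ?r0.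
    by rewrite le_max lexx orbT.
  by rewrite le_max lexx.
rewrite EFin_max ge_max; apply/andP; split; apply: ereal_sup_ubound.
  by exists [set x] => //; split.
by exists set0; [split => //; exact: bounded_borel0|rewrite r0].
Qed.

(** Through this domination, integrability for the total variation serves all four positive measures
    that make up the complex integral. *)
Lemma le_upper_total_variation (rho : set R -> R) A :
  (forall B, rho B <= normc (nu B)) ->
  (upper_variation rho A <= total_variation nu A)%E.
Proof.
move=> rho_le; apply: ge_ereal_sup => _ [B [bB BA] <-].
by apply: le_trans (normc_le_total_variation bB BA); rewrite lee_fin.
Qed.

Let part_le (f : R[i] -> R) (A : set R) : (forall z, `|f z| <= normc z) ->
  (upper_variation (fun B => f (nu B)) A <= total_variation nu A)%E /\
  (upper_variation (fun B => (- f (nu B))%R) A <= total_variation nu A)%E.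
Proof.
move=> fn; split.
  apply: (@le_upper_total_variation (fun B => f (nu B))) => B.
  exact: (le_trans (ler_norm _) (fn _)).
apply: (@le_upper_total_variation (fun B => - f (nu B))) => B.
by rewrite (le_trans _ (fn _))// -normrN ler_norm.
Qed.

Lemma re_pos_le A : (re_pos nu A <= total_variation nu A)%E.
Proof. exact: (part_le A (@normc_Re R)).1. Qed.

Lemma re_neg_le A : (re_neg nu A <= total_variation nu A)%E.
Proof. exact: (part_le A (@normc_Re R)).2. Qed.

Lemma im_pos_le A : (im_pos nu A <= total_variation nu A)%E.
Proof. exact: (part_le A (@normc_Im R)).1. Qed.

Lemma im_neg_le A : (im_neg nu A <= total_variation nu A)%E.
Proof. exact: (part_le A (@normc_Im R)).2. Qed.

End variations.

Lemma cvg_complex (R : realType) (z : nat -> R[i]) (l : R[i]) :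
  complex.Re (z n) @[n --> \oo] --> complex.Re l ->
  complex.Im (z n) @[n --> \oo] --> complex.Im l ->
  (z n : R[i]^o) @[n --> \oo] --> (l : R[i]^o).
Proof.
move=> zr zi; apply/cvg_normc => e e0.
have e2 : 0 < e / 2 by rewrite divr_gt0.
move/cvgrPdist_lt : zr => /(_ _ e2) zr; move/cvgrPdist_lt : zi => /(_ _ e2) zi.
apply: filterS2 zr zi => n; rewrite -!raddfB/= => hr hi.
have -> : l - z n = (complex.Re (l - z n))%:C + 'i%C * (complex.Im (l - z n))%:C.
  exact: complexE.
apply: le_lt_trans (le_normcD _ _) _; rewrite ComplexField.Normc.normcM/=.
rewrite !expr0n !addr0 expr1n add0r sqrtr1 mul1r !sqrtr_sqr.
by rewrite (splitr e) ltrD.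
Qed.

(** * Complex integrals: finite sums and dominated convergence *)

Section complex_integrals.
Context (R : realType) (nu : localComplexMeasure R).
Implicit Types (u : R -> R[i]) (f G : R -> R) (b x : R).
Local Notation pos := (`]0, +oo[%classic : set R).
Local Notation tv := (total_variation nu).

Lemma complex_integralE u : complex_integral nu u =
  ((\int[re_pos nu]_(x in pos) complex.Re (u x) - \int[re_neg nu]_(x in pos) complex.Re (u x))
   - (\int[im_pos nu]_(x in pos) complex.Im (u x) - \int[im_neg nu]_(x in pos) complex.Im (u x)))
  +i* ((\int[im_pos nu]_(x in pos) complex.Re (u x) - \int[im_neg nu]_(x in pos) complex.Re (u x))
   + (\int[re_pos nu]_(x in pos) complex.Im (u x) - \int[re_neg nu]_(x in pos) complex.Im (u x))).
Proof.
rewrite /complex_integral; apply/eqP; rewrite eq_complex/=.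
by apply/andP; split; apply/eqP; ring.
Qed.

(** The indicator is absorbed into the domain ]0, b]; finite point masses let [fine] pass through
    the sum. *)
Lemma Rintegral_truncated (mu : {measure set R -> \bar R}) b (s : seq R) f :
  uniq s -> [set` s] `<=` `]0, b]%classic ->
  mu (`]0, b]%classic `\` [set` s]) = 0%E ->
  (forall x, x \in s -> mu [set x] \is a fin_num) ->
  measurable_fun pos f ->
  \int[mu]_(x in pos) (f x * \1_(`]0, b]%classic) x) =
  \sum_(x <- s) f x * fine (mu [set x]).
Proof.
move=> us sb mub mufin mf; rewrite /Rintegral.
have bpos : `]0, b]%classic `<=` pos.
  by move=> x /=; rewrite !in_itv/= => /andP[-> _].
transitivity (fine (\int[mu]_(x in pos `&` `]0, b]%classic) (f x)%:E)).
  rewrite integral_mkcondr; congr fine; apply: eq_integral => x _.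
  by rewrite patchE indicE; case: ifP => _; rewrite ?mulr1 ?mulr0.
rewrite setIidr// (integral_finite_support (s := s))//; last exact: measurable_funS mf.
rewrite big_seq -sum_fine; last first.
  by move=> x xs; rewrite fin_numM// mufin.
rewrite [in RHS]big_seq; apply: eq_bigr => x xs.
by rewrite fineM// mufin.
Qed.

(** Each of the four positive measures reduces to point masses max (a, 0) or max (- a, 0), with a
    the real or imaginary part of the mass of [nu] at x; their differences restore a. *)
Lemma complex_integral_truncated b (s : seq R) u :
  uniq s -> [set` s] `<=` `]0, b]%classic ->
  (forall B, bounded_borel B -> B `<=` `]0, b]%classic `\` [set` s] -> nu B = 0) ->
  measurable_fun pos (fun x => complex.Re (u x)) ->
  measurable_fun pos (fun x => complex.Im (u x)) ->
  complex_integral nu (fun x => u x * (\1_(`]0, b]%classic) x)%:C) =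
  \sum_(x <- s) u x * nu [set x].
Proof.
move=> us sb nu0 mr mi.
have s0 x : x \in s -> 0 < x by move=> /sb; rewrite /= in_itv/= => /andP[].
have tv0 : tv (`]0, b]%classic `\` [set` s]) = 0%E by exact: total_variation_eq0.
have part (f : R -> R) (rho : set R -> R) (mu : {measure set R -> \bar R}) :
    measurable_fun pos f -> (mu : set R -> \bar R) = upper_variation rho ->
    rho set0 = 0 -> (forall A, mu A <= tv A)%E ->
  \int[mu]_(x in pos) (f x * \1_(`]0, b]%classic) x) =
    \sum_(x <- s) f x * Num.max (rho [set x]) 0.
  move=> mf muE rho0 mutv.
  have muE1 x : x \in s -> mu [set x] = (Num.max (rho [set x]) 0)%:E.
    by move=> xs; rewrite muE upper_variation_set1// s0.
  rewrite (Rintegral_truncated us sb)//.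
  - by rewrite big_seq [RHS]big_seq; apply: eq_bigr => x xs; rewrite muE1.
  - by apply/eqP; rewrite eq_le measure_ge0 andbT -tv0.
  - by move=> x xs; rewrite muE1.
have diff (f : R -> R) (rho : set R -> R) (mu1 mu2 : {measure set R -> \bar R}) :
    measurable_fun pos f -> (mu1 : set R -> \bar R) = upper_variation rho ->
    (mu2 : set R -> \bar R) = upper_variation (fun B => - rho B) ->
    rho set0 = 0 -> (forall A, mu1 A <= tv A)%E -> (forall A, mu2 A <= tv A)%E ->
  \int[mu1]_(x in pos) (f x * \1_(`]0, b]%classic) x) -
  \int[mu2]_(x in pos) (f x * \1_(`]0, b]%classic) x) =
    \sum_(x <- s) f x * rho [set x].
  move=> mf mu1E mu2E rho0 mu1tv mu2tv.
  rewrite (part f rho mu1)// (part f (fun B => - rho B) mu2)// ?rho0 ?oppr0//.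
  rewrite -sumrB; apply: eq_bigr => x _; rewrite -mulrBr; congr (_ * _).
  by rewrite /Num.max; case: ifP; case: ifP; lra.
have nu0' : nu set0 = 0 by exact: lcm0.
rewrite complex_integralE.
have reE : (fun x => complex.Re (u x * (\1_(`]0, b]%classic) x)%:C)) =
    (fun x => complex.Re (u x) * \1_(`]0, b]%classic) x).
  by apply/funext => x; case: (u x) => a c /=; rewrite mulr0 subr0.
have imE : (fun x => complex.Im (u x * (\1_(`]0, b]%classic) x)%:C)) =
    (fun x => complex.Im (u x) * \1_(`]0, b]%classic) x).
  by apply/funext => x; case: (u x) => a c /=; rewrite mulr0 add0r.
rewrite reE imE.
have re0 : complex.Re (nu set0) = 0 by rewrite nu0'.
have im0 : complex.Im (nu set0) = 0 by rewrite nu0'.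
have Re f mf := diff f (fun B => complex.Re (nu B)) (re_pos nu) (re_neg nu) mf
  erefl erefl re0 (re_pos_le nu) (re_neg_le nu).
have Im f mf := diff f (fun B => complex.Im (nu B)) (im_pos nu) (im_neg nu) mf
  erefl erefl im0 (im_pos_le nu) (im_neg_le nu).
rewrite (Re _ mr) (Re _ mi) (Im _ mr) (Im _ mi).
rewrite -sumrB -big_split/=.
apply/eqP; rewrite eq_complex/= !raddf_sum/=; apply/andP; split; apply/eqP;
  apply: eq_bigr => x _; case: (u x) => a c; case: (nu [set x]) => //=.
Qed.

(** Since mu <= |nu|, the majorant G is integrable for mu too, and dominated convergence applies. *)
Let part_cvg (mu : {measure set R -> \bar R}) (f_ : nat -> R -> R) f G :
  (forall A, mu A <= tv A)%E -> (forall n, measurable_fun pos (f_ n)) ->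
  measurable_fun pos G -> (\int[tv]_(x in pos) (G x)%:E < +oo)%E ->
  (forall x, 0 < x -> f_ n x @[n --> \oo] --> f x) ->
  (forall n x, 0 < x -> `|f_ n x| <= G x) ->
  \int[mu]_(x in pos) f_ n x @[n --> \oo] --> \int[mu]_(x in pos) f x.
Proof.
move=> mutv mf mG iG cf fG.
have posP x : pos x -> 0 < x by rewrite /= in_itv/= andbT.
have G0 x : pos x -> 0 <= G x.
  by move=> /posP x0; exact: le_trans (normr_ge0 _) (fG 0%N x x0).
have mGE : measurable_fun pos (EFin \o G) by exact/measurable_EFinP.
have iGmu : mu.-integrable pos (EFin \o G).
  apply/integrableP; split => //.
  have -> : (\int[mu]_(x in pos) `|(EFin \o G) x| = \int[mu]_(x in pos) (G x)%:E)%E.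
    by apply: eq_integral => x; rewrite inE => xpos; rewrite gee0_abs// lee_fin G0.
  apply: le_lt_trans iG.
  (* The measures are compared over the whole line, so G is cut off outside ]0, +oo[, where its sign
     is unknown. *)
  rewrite integral_mkcond [leRHS]integral_mkcond.
  apply: (@ge0_le_measure_integral _ _ _ mu tv) => //.
  - by move=> x; rewrite patchE; case: ifPn => //; rewrite inE => /G0; rewrite lee_fin.
  - exact/(measurable_restrictT (EFin \o G)).
have mfE n : measurable_fun pos (EFin \o f_ n) by exact/measurable_EFinP.
have cfE x : pos x -> ((EFin \o f_ n) x)%E @[n --> \oo] --> (EFin \o f) x.
  by move=> /posP x0; apply: cvg_EFin; [exact: nearW|exact: cf].
have fGE n x : pos x -> (`|(EFin \o f_ n) x| <= (EFin \o G) x)%E.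
  by move=> /posP x0; rewrite lee_fin fG.
have mflim : measurable_fun pos (EFin \o f) by exact: emeasurable_fun_cvg mfE cfE.
have [if_ _ cv] := @dominated_convergence _ _ _ mu pos (measurable_itv _)
  (fun n => EFin \o f_ n) _ _ mfE mflim (aeW _ cfE) iGmu (aeW _ (fun x n => @fGE n x)).
apply: fine_cvg; rewrite fineK; first exact: cv.
exact: integrable_fin_num.
Qed.

Lemma complex_integral_dominated_cvg (u_ : nat -> R -> R[i]) u G :
  (forall n, measurable_fun pos (fun x => complex.Re (u_ n x))) ->
  (forall n, measurable_fun pos (fun x => complex.Im (u_ n x))) ->
  measurable_fun pos G -> (\int[tv]_(x in pos) (G x)%:E < +oo)%E ->
  (forall x, 0 < x -> complex.Re (u_ n x) @[n --> \oo] --> complex.Re (u x)) ->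
  (forall x, 0 < x -> complex.Im (u_ n x) @[n --> \oo] --> complex.Im (u x)) ->
  (forall n x, 0 < x -> normc (u_ n x) <= G x) ->
  (complex_integral nu (u_ n) : R[i]^o) @[n --> \oo] -->
    (complex_integral nu u : R[i]^o).
Proof.
move=> mr mi mG iG cr ci uG.
have Gr n x : 0 < x -> `|complex.Re (u_ n x)| <= G x.
  by move=> x0; exact: le_trans (normc_Re _) (uG n x x0).
have Gi n x : 0 < x -> `|complex.Im (u_ n x)| <= G x.
  by move=> x0; exact: le_trans (normc_Im _) (uG n x x0).
have Re mu mutv := @part_cvg mu _ _ G mutv mr mG iG cr Gr.
have Im mu mutv := @part_cvg mu _ _ G mutv mi mG iG ci Gi.
rewrite (funext (fun n => complex_integralE (u_ n))) complex_integralE.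
apply: cvg_complex => /=.
  apply: cvgB; apply: cvgB.
  - exact: (Re _ (re_pos_le nu)).
  - exact: (Re _ (re_neg_le nu)).
  - exact: (Im _ (im_pos_le nu)).
  - exact: (Im _ (im_neg_le nu)).
apply: cvgD; apply: cvgB.
- exact: (Re _ (im_pos_le nu)).
- exact: (Re _ (im_neg_le nu)).
- exact: (Im _ (re_pos_le nu)).
- exact: (Im _ (re_neg_le nu)).
Qed.

End complex_integrals.

(** * Self-similar strings *)

Section words.
Context (N : nat).

(** The words of length at most n. The recursion splits off the first letter, as the self-similarity
    of the string does. *)
Fixpoint words n : seq (seq 'I_N) :=
  if n is n'.+1 then [::] :: [seq j :: J | j <- enum 'I_N, J <- words n'] else [:: [::]].

Lemma mem_words n J : (J \in words n) = (size J <= n)%N.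
Proof.
elim: n J => [|n IH] [|j J]//=; rewrite in_cons/= ltnS -IH.
apply/allpairsP/idP => [[[j' J']/= [_ J'n [_ ->]]]//|Jn].
by exists (j, J); rewrite mem_enum.
Qed.

Lemma words_uniq n : uniq (words n).
Proof.
elim: n => //= n IH; apply/andP; split.
  by apply/negP => /allpairsP[[j J] [_ _]].
by apply: allpairs_uniq; rewrite ?enum_uniq// => -[j J] [j' J'] _ _ [-> ->].
Qed.

Lemma big_words (V : nmodType) n (F : seq 'I_N -> V) :
  \sum_(J <- words n.+1) F J =
  F [::] + \sum_(j < N) \sum_(J <- words n) F (j :: J).
Proof. by rewrite big_cons big_allpairs_dep big_enum. Qed.

End words.

(** Conditions are encoded as multiples [*+] by a boolean, which makes sense in any additive
    monoid. *)
Lemma sum_seq_pred1 (T : eqType) (V : nmodType) (s : seq T) (F : T -> V) y : uniq s ->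
  \sum_(x <- s) F x *+ (y == x) = F y *+ (y \in s).
Proof.
move=> us; have [ys|ys] := boolP (y \in s).
  rewrite (bigD1_seq y)//= eqxx big1 ?addr0// => x.
  by rewrite eq_sym => /negbTE ->.
rewrite big_seq big1// => x xs.
by case: eqVneq => // yx; rewrite -yx (negbTE ys) in xs.
Qed.

(** * The atoms of a self-similar string *)

Section strings.
Context (R : realType) (K N : nat) (g : 'I_K -> R) (r : 'I_N -> R) (m : 'I_N -> R[i]).
Context (hg : forall k, 0 < g k) (hr : forall j, 0 < r j < 1).
Local Notation pos := (`]0, +oo[%classic : set R).
Local Notation eta := (self_similar_string m hg hr).
Implicit Types (b : R) (k : 'I_K) (J : seq 'I_N).

Definition string_point k J : R := (g k)^-1 * (word_prod r J)^-1.

Lemma word_prod_cons (T : pzSemiRingType) (a : 'I_N -> T) j J :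
  word_prod a (j :: J) = a j * word_prod a J.
Proof. by rewrite /word_prod big_cons. Qed.

Lemma word_prod_nil (T : pzSemiRingType) (a : 'I_N -> T) : word_prod a [::] = 1.
Proof. by rewrite /word_prod big_nil. Qed.

Lemma word_prod_gt0_le1 J : 0 < word_prod r J <= 1.
Proof.
have := @word_prod_le _ _ r 1 J; rewrite expr1n; apply => j.
by case/andP: (hr j) => -> /ltW ->.
Qed.

Lemma point_gt0 k J : 0 < string_point k J.
Proof.
by case/andP: (word_prod_gt0_le1 J) => rJ _; rewrite mulr_gt0// invr_gt0.
Qed.

Lemma point_cons k j J : string_point k (j :: J) = (r j)^-1 * string_point k J.
Proof. by rewrite /string_point word_prod_cons invfM mulrCA. Qed.

Lemma point_nil k : string_point k [::] = (g k)^-1.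
Proof. by rewrite /string_point word_prod_nil invr1 mulr1. Qed.

(** Products of ratios are at most 1, so no atom lies below 1 / g k. The 1 in the constant keeps it
    positive for an empty sum. A string thus has no mass near 0, which makes integrability of
    x^-sigma monotone in sigma. *)
Lemma point_ge : exists2 c, 0 < c & forall k J, c <= string_point k J.
Proof.
have G0 : 0 <= \sum_k g k by apply: sumr_ge0 => k _; exact: ltW.
exists (1 + \sum_k g k)^-1 => [|k J]; first by rewrite invr_gt0 ltr_pwDl.
case/andP: (word_prod_gt0_le1 J) => rJ rJ1.
rewrite /string_point -invfM lef_pV2 ?posrE ?mulr_gt0 ?ltr_pwDl//.
apply: (@le_trans _ _ (g k)); first by rewrite ler_piMr// ltW.
rewrite (bigD1 k)//= addrCA lerDl addr_ge0// sumr_ge0// => i _; exact: ltW.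
Qed.

(** An atom at most b has a product of ratios at least 1 / (g k b), which leaves finitely many words
    for each k. All n >= n0 are allowed because the functional equation compares the lengths n and n
    + 1. *)
Lemma point_le_words b :
  exists n0, forall n, (n0 <= n)%N -> forall k J, string_point k J <= b -> J \in words N n.
Proof.
have [b0|b0] := leP b 0.
  by exists 0%N => n _ k J /le_trans/(_ b0); rewrite leNgt point_gt0.
have bound k : exists n, forall J, string_point k J <= b -> (size J <= n)%N.
  have gb : 0 < (g k * b)^-1 by rewrite invr_gt0 mulr_gt0.
  have /finite_seqP[s sE] := finite_words hr gb.
  exists (\max_(J <- s) size J)%N => J pJ.
  have Js : J \in s.
    suff : [set` s] J by [].
    rewrite -sE/=; case/andP: (word_prod_gt0_le1 J) => rJ _.
    rewrite invf_ple ?posrE ?mulr_gt0//.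
    by rewrite -(@ler_pM2l _ (g k)^-1) ?invr_gt0// mulKf ?gt_eqF.
  by rewrite (big_rem J)//= leq_maxl.
have [n nE] := choice bound.
exists (\max_k n k)%N => n' n'n k J /nE Jn; rewrite mem_words.
by rewrite (leq_trans Jn)// (leq_trans _ n'n)// leq_bigmax.
Qed.

Lemma string_fun_words b n (A : set R) :
  (forall k J, string_point k J <= b -> J \in words N n) -> A `<=` `]0, b]%classic ->
  string_fun g r m A = \sum_k \sum_(J <- words N n) (\1_A (string_point k J))%:C * word_prod m J.
Proof.
move=> bn Ab; apply: eq_bigr => k _.
rewrite (fsbigE (words N n))/= ?words_uniq//.
- by apply: eq_big => J; rewrite ?in_setT// mulrC.
- move=> J _ Jk; rewrite indicE memNset ?mulr0// => /Ab.
  by rewrite /= in_itv/= => /andP[_ /bn]; apply/negP.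
Qed.

(** Different pairs of a gap and a word may give the same point, hence [undup]. *)
Definition string_points b n :=
  undup [seq x <- [seq string_point k J | k <- enum 'I_K, J <- words N n] | x <= b].

Lemma points_sub b n : [set` string_points b n] `<=` `]0, b]%classic.
Proof.
move=> x /=; rewrite mem_undup mem_filter in_itv/= => /andP[->].
by move=> /allpairsP[[k J] [_ _ ->]]; rewrite point_gt0.
Qed.

Lemma point_in_points b n k J : J \in words N n ->
  (string_point k J \in string_points b n) = (string_point k J <= b).
Proof.
move=> Jn; rewrite mem_undup mem_filter; case: leP => //= _.
by apply/allpairsP; exists (k, J); rewrite mem_enum.
Qed.

Lemma string_set1 b n x :
  (forall k J, string_point k J <= b -> J \in words N n) -> x \in string_points b n ->
  eta [set x] = \sum_k \sum_(J <- words N n) word_prod m J *+ (string_point k J == x).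
Proof.
move=> bn /points_sub xb; rewrite /= (string_fun_words bn); last by move=> _ ->.
apply: eq_bigr => k _; apply: eq_bigr => J _; rewrite indicE.
have -> : (string_point k J \in [set x]) = (string_point k J == x).
  by apply/idP/eqP; rewrite inE.
by case: (string_point k J == x); rewrite ?mul1r ?mul0r.
Qed.

Lemma string_eq0 b n B : (forall k J, string_point k J <= b -> J \in words N n) ->
  B `<=` `]0, b]%classic `\` [set` string_points b n] -> eta B = 0.
Proof.
move=> bn Bb; rewrite /= (string_fun_words bn); last first.
  by move=> x /Bb[].
rewrite big1// => k _; rewrite big_seq big1// => J Jn.
rewrite indicE memNset ?mul0r// => /Bb[]/=; rewrite in_itv/= point_in_points//.
by move=> /andP[_ ->].
Qed.

Lemma sum_points b n (V : nmodType) (F : R -> V) k J : J \in words N n ->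
  \sum_(x <- string_points b n) F x *+ (string_point k J == x) = F (string_point k J) *+ (string_point k J <= b)%R.
Proof. by move=> Jn; rewrite sum_seq_pred1 ?undup_uniq// point_in_points. Qed.

(** The mass at a point collects the multiplicities of all words landing there; exchanging the sums
    returns each word to its own point, so coincidences and cancellations need no separate
    treatment. *)
Lemma complex_integral_string_truncated b n (u : R -> R[i]) :
  (forall k J, string_point k J <= b -> J \in words N n) ->
  measurable_fun pos (fun x => complex.Re (u x)) ->
  measurable_fun pos (fun x => complex.Im (u x)) ->
  complex_integral eta (fun x => u x * (\1_(`]0, b]%classic) x)%:C) =
  \sum_k \sum_(J <- words N n)
    word_prod m J * u (string_point k J) *+ (string_point k J <= b)%R.
Proof.
move=> bn mr mi.
rewrite (complex_integral_truncated (undup_uniq _) (@points_sub b n))//; last first.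
  by move=> B _; exact: string_eq0.
rewrite big_seq; under eq_bigr => x xs do rewrite (string_set1 bn xs) mulr_sumr.
rewrite -big_seq exchange_big/=; apply: eq_bigr => k _.
under eq_bigr do rewrite mulr_sumr.
rewrite exchange_big/= big_seq [RHS]big_seq; apply: eq_bigr => J Jn.
rewrite -(@sum_points b n R[i] (fun x => word_prod m J * u x) k J Jn).
by apply: eq_bigr => x _; rewrite mulrnAr mulrC.
Qed.

End strings.

(** * Complex powers and integrability of real powers *)

Section complex_powers.
Context (R : realType).
Implicit Types (x y : R) (s : R[i]).
Local Notation pos := (`]0, +oo[%classic : set R).

Lemma cpowM x y s : 0 < x -> 0 < y -> cpow (x * y) s = cpow x s * cpow y s.
Proof.
by move=> x0 y0; rewrite !cpowE ?mulr_gt0// lnM// rmorphD mulrDl cexpD.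
Qed.

Lemma cpowVN x s : 0 < x -> cpow x^-1 (- s) = cpow x s.
Proof. by move=> x0; rewrite !cpowE ?invr_gt0// lnV// rmorphN/= mulrNN. Qed.

Lemma normc_cpow x s : 0 < x -> normc (cpow x s) = x `^ complex.Re s.
Proof.
move=> x0; rewrite cpowE// normc_cexp /powR gt_eqF//.
by case: s => a c /=; rewrite mul0r subr0 mulrC.
Qed.

Lemma cpow_Re x s : complex.Re (cpow x s) = x `^ complex.Re s * cos (complex.Im s * ln x).
Proof. by rewrite /cpow/= mul0r subr0. Qed.

Lemma cpow_Im x s : complex.Im (cpow x s) = x `^ complex.Re s * sin (complex.Im s * ln x).
Proof. by rewrite /cpow/= mul0r addr0. Qed.

Lemma measurable_cpow_Re s : measurable_fun pos (fun x => complex.Re (cpow x s)).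
Proof.
rewrite (funext (fun x => cpow_Re x s)).
apply: measurable_funTS; apply: measurable_funM; first exact: measurable_powR.
apply: measurableT_comp; first exact: (continuous_measurable_fun (@continuous_cos R)).
by apply: measurable_funM => //; exact: measurable_ln.
Qed.

Lemma measurable_cpow_Im s : measurable_fun pos (fun x => complex.Im (cpow x s)).
Proof.
rewrite (funext (fun x => cpow_Im x s)).
apply: measurable_funTS; apply: measurable_funM; first exact: measurable_powR.
apply: measurableT_comp; first exact: (continuous_measurable_fun (@continuous_sin R)).
by apply: measurable_funM => //; exact: measurable_ln.
Qed.

(** There is no mass below c, and for x >= c the factor x^(sigma' - sigma) is at most its value at
    c, the exponent being nonpositive. *)
Lemma powR_integrable_mono (mu : {measure set R -> \bar R}) (c sigma' sigma : R) :
  0 < c -> mu `]0, c[%classic = 0%E -> sigma' <= sigma ->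
  (\int[mu]_(x in pos) (x `^ (- sigma'))%:E < +oo)%E ->
  (\int[mu]_(x in pos) (x `^ (- sigma))%:E < +oo)%E.
Proof.
move=> c0 mu0 ss' fin.
have mpow a (D : set R) : measurable_fun D (fun x => (x `^ a)%:E).
  by apply/measurable_EFinP; apply: measurable_funTS; exact: measurable_powR.
have posE : pos = `]0, c[%classic `|` `[c, +oo[%classic.
  by rewrite -itv_bndbnd_setU// bnd_simp.
apply: (@le_lt_trans _ _ (\int[mu]_(x in pos) ((c `^ (sigma' - sigma))%:E * (x `^ (- sigma'))%:E))%E); last first.
  rewrite ge0_integralZl//; last by rewrite lee_fin powR_ge0.
    by rewrite lte_mul_pinfty// lee_fin powR_ge0.
  by move=> x _; rewrite lee_fin powR_ge0.
rewrite posE !ge0_integral_setU//=; first last.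
- rewrite disj_set2E; apply/eqP/seteqP; split => // x [] /=.
  by rewrite !in_itv/= => /andP[_]; rewrite andbT ltNge => /negP.
- by move=> x _; rewrite lee_fin powR_ge0.
- rewrite disj_set2E; apply/eqP/seteqP; split => // x [] /=.
  by rewrite !in_itv/= => /andP[_]; rewrite andbT ltNge => /negP.
- by move=> x _; rewrite mule_ge0// lee_fin powR_ge0.
- exact: emeasurable_funM.
rewrite (@null_set_integral _ _ _ mu)//= add0e.
apply: (@le_trans _ _ (\int[mu]_(x in `[c, +oo[) ((c `^ (sigma' - sigma))%:E * (x `^ (- sigma'))%:E))%E); last first.
  by apply: leeDr; apply: integral_ge0 => x _; rewrite mule_ge0// lee_fin powR_ge0.
apply: ge0_le_integral => //=.
- by move=> x _; rewrite lee_fin powR_ge0.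
- exact: emeasurable_funM.
move=> x; rewrite /= in_itv/= andbT => cx; rewrite -EFinM lee_fin.
have x0 : 0 < x by exact: lt_le_trans cx.
have -> : x `^ (- sigma) = x `^ (sigma' - sigma) * x `^ (- sigma').
  by rewrite -powRD ?[x == 0]gt_eqF ?implybT//; congr (_ `^ _); ring.
rewrite ler_wpM2r ?powR_ge0// /powR !gt_eqF// ler_expR.
by apply: ler_wnM2l; rewrite ?subr_le0// ler_ln// posrE.
Qed.

End complex_powers.

(** * The functional equation of the truncated zeta function *)

Section string_zeta.
Context (R : realType) (K N : nat) (g : 'I_K -> R) (r : 'I_N -> R) (m : 'I_N -> R[i]).
Context (hg : forall k, 0 < g k) (hr : forall j, 0 < r j < 1).
Local Notation eta := (self_similar_string m hg hr).
Local Notation pos := (`]0, +oo[%classic : set R).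
Local Notation tv := (total_variation eta).
Local Notation point := (string_point g r).
Implicit Types (b c sigma : R) (s : R[i]).

(** Only finitely many atoms lie in ]0, b], so this is a finite sum for every s, whatever the
    dimension. *)
Definition truncated_zeta b s : R[i] :=
  complex_integral eta (fun x => cpow x (- s) * (\1_(`]0, b]%classic) x)%:C).

Lemma truncated_zetaE b n s :
  (forall k J, point k J <= b -> J \in words N n) ->
  truncated_zeta b s =
  \sum_k \sum_(J <- words N n) word_prod m J * cpow (point k J) (- s) *+ (point k J <= b)%R.
Proof.
move=> bn; rewrite /truncated_zeta (complex_integral_string_truncated _ _ _ bn)//.
  exact: measurable_cpow_Re.
exact: measurable_cpow_Im.
Qed.

(* eta is the sum of the point masses at (g k)^-1 and of the copies of m j eta dilated
   by (r j)^-1; this is that identity on ]0, b]. *)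
Lemma truncated_zeta_eq b s : 0 < b ->
  truncated_zeta b s = \sum_k cpow (g k) s *+ ((g k)^-1 <= b)%R +
    \sum_j m j * cpow (r j) s * truncated_zeta (r j * b) s.
Proof.
move=> b0; have [n bn] := point_le_words hg hr b.
have rb j : forall k J, point k J <= r j * b -> J \in words N n.
  move=> k J pb; apply: (bn n (leqnn n) k); apply: (le_trans pb).
  by case/andP: (hr j) => r0 /ltW r1; rewrite ler_piMl// ltW.
under [X in _ + X]eq_bigr => j _ do rewrite (truncated_zetaE _ (rb j)) mulr_sumr.
(* Length n + 1 on the left against n on the right: dropping the first letter j shortens a word by
   one and moves the cutoff from b to r j b. *)
rewrite (truncated_zetaE _ (bn n.+1 (leqnSn n))) [X in _ = _ + X]exchange_big/= -big_split/=.
apply: eq_bigr => k _; rewrite big_words; congr (_ + _).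
  by rewrite point_nil word_prod_nil mul1r cpowVN.
apply: eq_bigr => j _; rewrite mulr_sumr; apply: eq_bigr => J _.
have /andP[rj0 _] := hr j.
rewrite point_cons word_prod_cons cpowM ?invr_gt0 ?(point_gt0 hg hr)// cpowVN//.
rewrite ler_pdivrMl// mulrnAr; congr (_ *+ _); ring.
Qed.

Lemma tv_integrable_mono sigma sigma' : sigma' <= sigma ->
  (\int[tv]_(x in pos) (x `^ (- sigma'))%:E < +oo)%E ->
  (\int[tv]_(x in pos) (x `^ (- sigma))%:E < +oo)%E.
Proof.
have [c c0 hc] := point_ge hg hr.
apply: (powR_integrable_mono c0).
apply: total_variation_eq0 => B _ Bc; rewrite /= /string_fun big1// => k _.
rewrite fsbig1// => J _; rewrite indicE memNset ?mulr0// => /Bc.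
by rewrite /= in_itv/= => /andP[_]; rewrite ltNge; apply/negP; rewrite negbK; exact: hc.
Qed.

(** The infimum only yields some integrable exponent below sigma; monotonicity carries it up to
    sigma. *)
Lemma tv_integrable sigma : (lcm_dimension eta < sigma%:E)%E ->
  (\int[tv]_(x in pos) (x `^ (- sigma))%:E < +oo)%E.
Proof.
move=> /ereal_inf_lt[_ [sigma' fin <-]]; rewrite lte_fin => /ltW ss'.
exact: tv_integrable_mono fin.
Qed.

End string_zeta.

Lemma cvg_linear_combination (F : numFieldType) (I : finType) (a : I -> F)
    (z : nat -> I -> F) (l : I -> F) :
  (forall i, (z n i : F^o) @[n --> \oo] --> (l i : F^o)) ->
  (\sum_i a i * z n i : F^o) @[n --> \oo] --> (\sum_i a i * l i : F^o).
Proof.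
move=> zl; elim: (index_enum I) => [|i s IH].
  by rewrite big_nil (_ : (fun n => _) = cst 0); [exact: cvg_cst|apply/funext => n; rewrite big_nil].
rewrite big_cons (_ : (fun n => _) = (fun n => a i * z n i + \sum_(j <- s) a j * z n j)).
  have h : (a i * z n i : F^o) @[n --> \oo] --> (a i * l i : F^o).
    by apply: cvgMl_tmp; exact: zl.
  exact: (cvgD h IH).
by apply/funext => n; rewrite big_cons.
Qed.

(** Monotone convergence along the intervals ]0, n + 1], which exhaust ]0, +oo[. *)
Lemma integral_pos_lt_pinfty (R : realType) (mu : {measure set R -> \bar R})
    (f : R -> R) (B : R) : measurable_fun setT f -> (forall x, 0 <= f x) ->
  (forall n : nat, (\int[mu]_(x in `]0%R, n.+1%:R]) (f x)%:E <= B%:E)%E) ->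
  (\int[mu]_(x in `]0%R, +oo[) (f x)%:E < +oo)%E.
Proof.
move=> mf f0 fB.
have posE : `]0, +oo[%classic = \bigcup_n `]0%R, (n.+1%:R : R)]%classic.
  apply/seteqP; split => [x|x [n _]] /=; rewrite !in_itv/= ?andbT; last by case/andP.
  move=> x0; exists (Num.bound x) => //=; rewrite in_itv/= x0/=.
  by rewrite (le_trans (ltW (archi_boundP (ltW x0))))// ler_nat.
rewrite posE; apply: (@le_lt_trans _ _ B%:E); last exact: ltry.
have mE D : measurable_fun D (EFin \o f).
  by apply/measurable_EFinP; exact: measurable_funTS.
have cv := @ge0_nondecreasing_set_cvg_integral _ _ _ (fun n => `]0%R, (n.+1%:R : R)]%classic)
  (EFin \o f) mu _ (fun i => measurable_itv _) (fun i => mE _) _.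
rewrite -(cvg_lim _ (cv _ _))//; first last.
- by move=> i x _; rewrite lee_fin.
- apply/nondecreasing_seqP => n; rewrite subsetEset => x /=; rewrite !in_itv/= => /andP[-> /le_trans]/=.
  by apply; rewrite ler_nat.
apply: lime_le; last by apply: nearW => n; exact: fB.
apply/cvg_ex; eexists; apply: cv.
  apply/nondecreasing_seqP => n; rewrite subsetEset => x /=; rewrite !in_itv/= => /andP[-> /le_trans]/=.
  by apply; rewrite ler_nat.
by move=> i x _; rewrite lee_fin.
Qed.

(** * Passage to the limit in the functional equation *)

Section string_zeta.
Context (R : realType) (K N : nat) (g : 'I_K -> R) (r : 'I_N -> R) (m : 'I_N -> R[i]).
Context (hg : forall k, 0 < g k) (hr : forall j, 0 < r j < 1).
Local Notation eta := (self_similar_string m hg hr).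
Local Notation pos := (`]0, +oo[%classic : set R).
Local Notation tv := (total_variation eta).
Local Notation point := (string_point g r).
Local Notation truncated_zeta := (truncated_zeta m hg hr).
Implicit Types (b c sigma : R) (s : R[i]).

Lemma measurable_powR_pos a : measurable_fun pos (fun x : R => x `^ a).
Proof. by apply: measurable_funTS; exact: measurable_powR. Qed.

(** Dominated convergence with majorant |x^-s|: at each x the indicator is eventually 1. The factor
    c accounts for the rescaled cutoffs r j b of the functional equation. *)
Lemma truncated_zeta_cvg c s : 0 < c -> (lcm_dimension eta < (complex.Re s)%:E)%E ->
  (truncated_zeta (c * n.+1%:R) s : R[i]^o) @[n --> \oo] --> (geometric_zeta eta s : R[i]^o).
Proof.
move=> c0 Ds.
have near1 x : 0 < x -> \forall n \near \oo, \1_(`]0, (c * n.+1%:R)]%classic) x = 1 :> R.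
  move=> x0; near=> n; rewrite indicE mem_set//= in_itv/= x0/= -ler_pdivrMl//.
  by rewrite -natr1 ler_wpDr//; near: n; exact: nbhs_infty_ger.
apply: (complex_integral_dominated_cvg (G := fun x => x `^ (- complex.Re s))).
- move=> n; rewrite (_ : (fun x => _) = (fun x => complex.Re (cpow x (- s)) * \1_(`]0, (c * n.+1%:R)]%classic) x)).
    by apply: measurable_funM; [exact: measurable_cpow_Re|exact: measurable_indic].
  by apply/funext => x; case: (cpow x _) => u v /=; rewrite mulr0 subr0.
- move=> n; rewrite (_ : (fun x => _) = (fun x => complex.Im (cpow x (- s)) * \1_(`]0, (c * n.+1%:R)]%classic) x)).
    by apply: measurable_funM; [exact: measurable_cpow_Im|exact: measurable_indic].
  by apply/funext => x; case: (cpow x _) => u v /=; rewrite mulr0 add0r.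
- exact: measurable_powR_pos.
- exact: tv_integrable.
- move=> x x0; apply: cvg_near_cst; apply: filterS (near1 x x0) => n ->.
  by rewrite mulr1.
- move=> x x0; apply: cvg_near_cst; apply: filterS (near1 x x0) => n ->.
  by rewrite mulr1.
- move=> n x x0; rewrite ComplexField.Normc.normcM normc_cpow//.
  have -> : complex.Re (- s) = - complex.Re s by case: (s).
  rewrite ler_piMr ?powR_ge0//= expr0n addr0 sqrtr_sqr indicE.
  by case: (_ \in _); rewrite ?normr0 ?normr1.
Unshelve. all: by end_near. Qed.

(** Both sides of the truncated equation at b = n + 1 converge, the left one with c = 1 and the
    right one with c = r j, and limits are unique. *)
Lemma geometric_zeta_eq s : (lcm_dimension eta < (complex.Re s)%:E)%E ->
  geometric_zeta eta s * (1 - \sum_j m j * cpow (r j) s) = \sum_k cpow (g k) s.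
Proof.
move=> Ds.
have lhs := truncated_zeta_cvg ltr01 Ds.
have rhs := @cvg_linear_combination R[i] _ (fun j => m j * cpow (r j) s) _ _
  (fun j => truncated_zeta_cvg (proj1 (andP (hr j))) Ds).
have gk : \forall n \near \oo, \sum_k cpow (g k) s *+ ((g k)^-1 <= 1 * n.+1%:R :> R)%R = \sum_k cpow (g k) s.
  apply: near_eq_sum => k; near=> n; rewrite mul1r.
  suff -> : (g k)^-1 <= n.+1%:R by [].
  by rewrite -natr1 ler_wpDr//; near: n; exact: nbhs_infty_ger.
have {}rhs : (\sum_k cpow (g k) s *+ ((g k)^-1 <= 1 * n.+1%:R :> R)%R +
    \sum_j m j * cpow (r j) s * truncated_zeta (r j * n.+1%:R) s : R[i]^o) @[n --> \oo] -->
    (\sum_k cpow (g k) s + \sum_j m j * cpow (r j) s * geometric_zeta eta s : R[i]^o).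
  by apply: (@cvgD _ R[i]^o); [exact: cvg_near_cst|exact: rhs].
have {}rhs : (truncated_zeta (1 * n.+1%:R) s : R[i]^o) @[n --> \oo] -->
    (\sum_k cpow (g k) s + \sum_j m j * cpow (r j) s * geometric_zeta eta s : R[i]^o).
  apply: cvg_trans rhs; apply: near_eq_cvg; apply: filterE => n.
  by rewrite mul1r truncated_zeta_eq// mul1r.
have zE : geometric_zeta eta s = \sum_k cpow (g k) s + \sum_j m j * cpow (r j) s * geometric_zeta eta s.
  exact: (@cvg_unique R[i]^o (@norm_hausdorff R[i] R[i]^o) _ _ _ _ lhs rhs).
rewrite mulrBr mulr1 {1}zE -mulr_suml; ring.
Unshelve. all: by end_near. Qed.

End string_zeta.

Lemma normc_sum (R : realType) (T : Type) (s : seq T) (F : T -> R[i]) :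
  normc (\sum_(i <- s) F i) <= \sum_(i <- s) normc (F i).
Proof.
elim/big_ind2 : _ => //; first by rewrite ComplexField.Normc.normc0.
move=> a b c d ab cd; apply: (le_trans (le_normcD _ _)); exact: lerD.
Qed.

(** * Finiteness of the dimension and continuity of zeta from the right *)

Section string_dimension.
Context (R : realType) (K N : nat) (g : 'I_K -> R) (r : 'I_N -> R) (m : 'I_N -> R[i]).
Context (hg : forall k, 0 < g k) (hr : forall j, 0 < r j < 1).
Local Notation eta := (self_similar_string m hg hr).
Local Notation pos := (`]0, +oo[%classic : set R).
Local Notation tv := (total_variation eta).
Local Notation point := (string_point g r).
Implicit Types (b c sigma : R) (s : R[i]).

(** Each r j < 1, so the finite sum tends to 0 as p grows. *)
Lemma exists_contracting_power : exists p, \sum_j normc (m j) * r j ^+ p <= 2^-1.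
Proof.
have rj j : (r j ^+ n : R^o) @[n --> \oo] --> (0 : R^o).
  by case/andP: (hr j) => r0 r1; apply: cvg_expr; rewrite gtr0_norm.
have := @cvg_linear_combination R _ (fun j => normc (m j)) (fun n j => r j ^+ n) (fun=> 0) rj.
rewrite big1 => [|j _]; last by rewrite mulr0.
have e0 : 0 < 2^-1 :> R by [].
move=> /cvgrPdist_le/(_ _ e0)[p _ /(_ p (leqnn p))]; rewrite sub0r normrN => h.
by exists p; exact: le_trans (ler_norm _) h.
Qed.

(** Splitting off the first letter turns a sum A into 1 + q A with q <= 1/2, and the bound 2 is
    preserved because 1 + 2/2 = 2. *)
Lemma word_sum_le2 p n : \sum_j normc (m j) * r j ^+ p <= 2^-1 ->
  \sum_(J <- words N n) normc (word_prod m J) * word_prod r J ^+ p <= 2.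
Proof.
move=> hp; have F0 : normc (word_prod m [::]) * word_prod r [::] ^+ p = 1 :> R.
  by rewrite !word_prod_nil expr1n ComplexField.Normc.normc1 mul1r.
elim: n => [|n IH]; first by rewrite big_seq1 F0 ler1n.
rewrite big_words F0.
have -> : \sum_j \sum_(J <- words N n) normc (word_prod m (j :: J)) * word_prod r (j :: J) ^+ p =
  (\sum_j normc (m j) * r j ^+ p) *
  (\sum_(J <- words N n) normc (word_prod m J) * word_prod r J ^+ p).
  rewrite mulr_suml; apply: eq_bigr => j _; rewrite mulr_sumr; apply: eq_bigr => J _.
  by rewrite !word_prod_cons ComplexField.Normc.normcM exprMn; ring.
set A := \sum_(J <- _) _ in IH *; set q := \sum_j _ in hp *.
have q0 : 0 <= q.
  apply: sumr_ge0 => j _; rewrite mulr_ge0 ?normc_ge0// exprn_ge0//.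
  by case/andP: (hr j) => /ltW.
by have := ler_wpM2l q0 IH; lra.
Qed.

Lemma powR_point k J (p : nat) : point k J `^ (- p%:R) = g k ^+ p * word_prod r J ^+ p.
Proof.
rewrite powR_invn ?(ltW (point_gt0 hg hr _ _))// /string_point.
by rewrite -invfM exprVn invrK exprMn.
Qed.

(** The triangle inequality bounds the mass at a point by the moduli of the multiplicities of the
    words landing there; summing by words gives a bound independent of b. *)
Lemma tv_truncated_le p b : \sum_j normc (m j) * r j ^+ p <= 2^-1 ->
  (\int[tv]_(x in `]0%R, b]) (x `^ (- p%:R))%:E <= (\sum_k g k ^+ p * 2)%:E)%E.
Proof.
move=> hp; have [n /(_ n (leqnn n)) bn] := point_le_words hg hr b.
have sb := @points_sub R K N g r hg hr b n.
have tv0 : tv (`]0, b]%classic `\` [set` string_points g r b n]) = 0%E.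
  by apply: total_variation_eq0 => B _; exact: (string_eq0 m hg hr bn).
rewrite (integral_finite_support (s := string_points g r b n))//; last 2 first.
  exact: undup_uniq.
  by apply: measurable_funTS; exact: measurable_powR.
rewrite (eq_big_seq (fun x => (x `^ (- p%:R) * normc
    (\sum_k \sum_(J <- words N n) word_prod m J *+ (point k J == x)))%:E)); last first.
  move=> x xs; rewrite EFinM -(string_set1 m hg hr bn xs); congr (_ * _)%E.
  apply: total_variation_set1.
  by move: (sb x xs); rewrite /= in_itv/= => /andP[].
rewrite sumEFin lee_fin.
apply: (@le_trans _ _ (\sum_(x <- string_points g r b n) \sum_k \sum_(J <- words N n)
    x `^ (- p%:R) * normc (word_prod m J) *+ (point k J == x))).
  apply: ler_sum => x _.
  apply: (le_trans (ler_wpM2l (powR_ge0 _ _) (normc_sum _ _))).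
  rewrite mulr_sumr; apply: ler_sum => k _.
  apply: (le_trans (ler_wpM2l (powR_ge0 _ _) (normc_sum _ _))).
  rewrite mulr_sumr; apply: ler_sum => J _.
  by case: eqP => _; rewrite ?mulr1n ?mulr0n ?ComplexField.Normc.normc0 ?mulr0.
rewrite exchange_big/=; apply: ler_sum => k _.
rewrite exchange_big/=.
apply: (@le_trans _ _ (\sum_(J <- words N n) g k ^+ p * (normc (word_prod m J) * word_prod r J ^+ p))).
  rewrite big_seq [leRHS]big_seq; apply: ler_sum => J Jn.
  rewrite (sum_points g r b (fun x => x `^ (- p%:R) * normc (word_prod m J)))//.
  rewrite powR_point mulrAC -mulrA.
  case: (_ <= b); rewrite ?mulr1n ?mulr0n ?lexx//.
  have /andP[/ltW rJ _] := word_prod_gt0_le1 hr J.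
  by rewrite !mulr_ge0 ?normc_ge0 ?exprn_ge0// ltW.
by rewrite -mulr_sumr ler_wpM2l ?exprn_ge0 ?(ltW (hg k))// word_sum_le2.
Qed.

(** A contracting power p is an integrable exponent, hence an upper bound for the dimension. *)
Lemma string_dimension_lt_pinfty : (lcm_dimension eta < +oo)%E.
Proof.
have [p hp] := exists_contracting_power.
apply: (@le_lt_trans _ _ p%:R%:E); last exact: ltry.
apply: ereal_inf_lbound; exists p%:R => //.
apply: (@integral_pos_lt_pinfty _ tv _ (\sum_k g k ^+ p * 2)).
- exact: measurable_powR.
- by move=> x; exact: powR_ge0.
- by move=> n; exact: tv_truncated_le.
Qed.

(* The majorant is x^-sigma + x^(-sigma-1), which takes care of x < 1 and x >= 1. *)
Lemma geometric_zeta_cvg s : (lcm_dimension eta < (complex.Re s)%:E)%E ->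
  (geometric_zeta eta (s + (n.+1%:R^-1)%:C) : R[i]^o) @[n --> \oo] -->
    (geometric_zeta eta s : R[i]^o).
Proof.
move=> Ds; have Ds1 : (lcm_dimension eta < (complex.Re s + 1)%:E)%E.
  by rewrite (lt_le_trans Ds)// lee_fin lerDl.
have reE n : complex.Re (- (s + (n.+1%:R^-1)%:C)) = - complex.Re s - n.+1%:R^-1.
  by case: (s) => u v /=; rewrite opprD.
have imE n : complex.Im (- (s + (n.+1%:R^-1)%:C)) = complex.Im (- s).
  by case: (s) => u v /=; rewrite addr0.
have reN : complex.Re (- s) = - complex.Re s by case: (s).
have pw x : 0 < x -> x `^ (- complex.Re s - n.+1%:R^-1) @[n --> \oo] --> x `^ (- complex.Re s).
  move=> x0; rewrite /powR gt_eqF//.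
  apply: continuous_cvg; first exact: continuous_expR.
  apply: cvgMr_tmp; rewrite -[X in _ --> X]subr0.
  by apply: cvgB; [exact: cvg_cst|exact: cvg_harmonic].
apply: (complex_integral_dominated_cvg
  (G := fun x => x `^ (- complex.Re s) + x `^ (- (complex.Re s + 1)))).
- by move=> n; exact: measurable_cpow_Re.
- by move=> n; exact: measurable_cpow_Im.
- by apply: measurable_funD; exact: measurable_powR_pos.
- under eq_integral do rewrite EFinD.
  rewrite ge0_integralD//.
  + by apply: lte_add_pinfty; exact: tv_integrable.
  + by move=> x _; rewrite lee_fin powR_ge0.
  + by apply/measurable_EFinP; exact: measurable_powR_pos.
  + by move=> x _; rewrite lee_fin powR_ge0.
  + by apply/measurable_EFinP; exact: measurable_powR_pos.
- move=> x x0; rewrite cpow_Re reN; under eq_fun do rewrite cpow_Re reE imE.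
  by apply: cvgMr_tmp; exact: pw.
- move=> x x0; rewrite cpow_Im reN; under eq_fun do rewrite cpow_Im reE imE.
  by apply: cvgMr_tmp; exact: pw.
- move=> n x x0; rewrite normc_cpow// reE.
  have n1 : n.+1%:R^-1 <= 1 :> R by rewrite invf_le1// ler1n.
  have n0 : 0 <= n.+1%:R^-1 :> R by rewrite invr_ge0.
  move: (n.+1%:R^-1) n1 n0 => e e1 e0.
  have [x1|x1] := leP 1 x.
    by rewrite ler_wpDr ?powR_ge0// ler_powR// gerBl.
  rewrite ler_wpDl ?powR_ge0// /powR gt_eqF// ler_expR.
  by have := ln_le0 (ltW x1); nra.
Qed.

End string_dimension.

(** The sequence never meets p, so limits over the punctured neighbourhood can be tested along it;
    moving to the right, it stays in any half-plane Re s > D containing p. *)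
Lemma cvg_harmonic_dnbhs (R : realType) (p : R[i]) :
  (p + (n.+1%:R^-1)%:C : R[i]^o) @[n --> \oo] --> (p : R[i]^o)^'.
Proof.
have cv : (p + (n.+1%:R^-1)%:C : R[i]^o) @[n --> \oo] --> (p : R[i]^o).
  apply/cvg_normc => e e0.
  have /cvgrPdist_lt/(_ _ e0) : (n.+1%:R^-1 : R) @[n --> \oo] --> (0 : R).
    exact: cvg_harmonic.
  apply: filterS => n; rewrite sub0r normrN.
  by rewrite opprD addrA subrr add0r -rmorphN/= expr0n addr0 sqrtr_sqr normrN.
move=> A pA.
have H : \forall n \near \oo, p + (n.+1%:R^-1)%:C != p -> A (p + (n.+1%:R^-1)%:C) := cv _ pA.
have : \forall n \near \oo, A (p + (n.+1%:R^-1)%:C); last by [].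
apply: filterS H => n; apply; rewrite -subr_eq0 addrAC subrr add0r.
by rewrite fmorph_eq0 invr_eq0 pnatr_eq0.
Qed.

(** * The meromorphic continuation *)

Theorem theorem3p12 (R : realType) (K N : nat) (hK : (0 < K)%N) (hN : (0 < N)%N)
    (g : 'I_K -> R) (r : 'I_N -> R) (m : 'I_N -> R[i])
    (hg : forall k, 0 < g k) (hr : forall j, 0 < r j < 1) :
  let eta := self_similar_string m hg hr in
  (lcm_dimension eta < +oo)%E /\
  exists Z : R[i] -> R[i],
    [/\ meromorphic Z,
        forall s : R[i], (lcm_dimension eta < (complex.Re s)%:E)%E ->
          Z s = geometric_zeta eta s &
        meromorphic_quotient Z
          (fun s => \sum_(k < K) cpow (g k) s)
          (fun s => 1 - \sum_(j < N) m j * cpow (r j) s)].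
Proof.
move=> eta; split; first exact: string_dimension_lt_pinfty.
pose f s : R[i] := \sum_(k < K) cpow (g k) s.
pose h s : R[i] := 1 - \sum_(j < N) m j * cpow (r j) s.
pose lf k := ln (g k).
(* Index 0 carries the constant term 1, with exponent 0; the remaining indices carry - m j, with
   exponent ln (r j). *)
pose ch (i : 'I_N.+1) : R[i] := if unlift ord0 i is Some j then - m j else 1.
pose lh (i : 'I_N.+1) : R := if unlift ord0 i is Some j then ln (r j) else 0.
have fE : f = exp_sum (fun=> 1) lf.
  by apply/funext => s; apply: eq_bigr => k _; rewrite mul1r cpowE.
have hE : h = exp_sum ch lh.
  apply/funext => s; rewrite /exp_sum big_ord_recl /ch /lh unlift_none.
  rewrite mul0r cexp0 mulr1 /h; congr (_ + _); rewrite -sumrN.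
  apply: eq_bigr => j _; rewrite liftK mulNr cpowE//.
  by case/andP: (hr j).
(* Since ln (r j) < 0, only the constant term has exponent 0, and it cannot be cancelled: h has a
   nonzero Taylor coefficient at every p. *)
have ex p : exists k, exp_sum_coef ch lh p k != 0.
  apply: (@exp_sum_coef_neq0 _ _ ch lh p ord0).
  rewrite (big_pred1 ord0) => [|i].
    by rewrite /ch /lh unlift_none mul0r cexp0 mulr1 oner_eq0.
  rewrite /lh unlift_none; case: unliftP => [j ->|->]; last by rewrite !eqxx.
  have /andP[r0 r1] := hr j.
  by rewrite lt_eqF ?ln_lt0 ?r0//; apply/esym/negbTE; rewrite eq_sym neq_lift.
have isoz p : \forall s \near (p : R[i]^o)^', h s != 0.
  by rewrite hE; exact: exp_sum_isolated_zeros.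
have zetaE s : (lcm_dimension eta < (complex.Re s)%:E)%E -> h s != 0 ->
    geometric_zeta eta s = f s / h s.
  by move=> Ds hs; rewrite /f -(geometric_zeta_eq Ds) mulfK.
(* At a zero of h inside the half-plane the value must be that of zeta; elsewhere it is the limit of
   f / h, which has meaning only when the singularity is removable. *)
pose Z s : R[i] := if h s != 0 then f s / h s else
  if (lcm_dimension eta < (complex.Re s)%:E)%E then geometric_zeta eta s
  else lim ((f t / h t : R[i]^o) @[t --> (s : R[i]^o)^']).
have Zfh s : h s != 0 -> Z s = f s / h s by rewrite /Z => ->.
exists Z; split => //.
- apply: (@meromorphic_exp_sum_quotient _ _ _ (fun=> 1) lf ch lh) => //.
    by rewrite -fE -hE.
  rewrite -fE -hE => p L hp cvL; rewrite /Z hp eqxx/=; case: ifPn => [Dp|_]; last first.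
    exact: (cvg_lim (@norm_hausdorff R[i] R[i]^o) cvL).
  (* Along p + 1 / (n + 1), which stays in the half-plane and eventually avoids the zeros of h, zeta
     equals f / h; the two limits therefore coincide. *)
  have cv1 := geometric_zeta_cvg Dp.
  have cvh := @cvg_harmonic_dnbhs R p.
  have cv2 : (f (p + (n.+1%:R^-1)%:C) / h (p + (n.+1%:R^-1)%:C) : R[i]^o) @[n --> \oo] -->
      (L : R[i]^o) by move=> A /cvL /cvh.
  apply: (@cvg_unique R[i]^o (@norm_hausdorff R[i] R[i]^o) _ _ _ _ cv1).
  apply: cvg_trans cv2; apply: near_eq_cvg.
  have hn : \forall n \near \oo, h (p + (n.+1%:R^-1)%:C) != 0 := cvh _ (isoz p).
  apply: filterS hn => n hn.
  rewrite zetaE//; case: (p) Dp => u v /= Dp.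
  by rewrite (lt_le_trans Dp)// lee_fin lerDl invr_ge0.
- move=> s Ds; rewrite /Z; case: ifPn => [hs|_]; first by rewrite zetaE.
  by rewrite Ds.
Qed.
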